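(* FZA is strongly NP-hard, even when restricted to instances whose tree $T$ is a path.
   Context: Fare Zone Assignment (FZA): given a tree $T=(V,E)$, a non-decreasing concave function $f\colon\mathbb{N}_0\to\mathbb{R}_{\ge 0}$, and commodities $i\in[k]$, each given by a path $P_i\subseteq E$, a bound $u_i\in\mathbb{N}_0$ and a weight $w_i\in\mathbb{N}$, find $F\subseteq E$ maximizing $\sum_{i\in[k]}\mathrm{rev}_i(F)$, where $\mathrm{rev}_i(F)=w_i f(|P_i\cap F|)$ if $|P_i\cap F|\le u_i$ and $0$ otherwise. (The decision version asks whether revenue at least a given target is achievable.) *)

(* Defs.v *)
From HB Require Import structures.
From mathcomp Require Import all_boot all_order all_algebra.

Set Implicit Arguments.
Unset Strict Implicit.
Unset Printing Implicit Defensive.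

Import Order.TTheory GRing.Theory Num.Theory.

(** * Deterministic multi-tape Turing machines *)

Inductive direction := GoLeft | Stay | GoRight.

(* The machine has [work_tapes.+1] tapes, all two-way infinite.  A cell is
   blank ([None]), carries a bit ([Some (inl b)]), or carries one of the
   machine's auxiliary symbols ([Some (inr a)]). *)
Record machine := Machine {
  work_tapes : nat;
  aux : finType;
  state : finType;
  start : state;
  halting : pred state;
  trans : state -> ('I_work_tapes.+1 -> option (bool + aux)) ->
          state * ('I_work_tapes.+1 -> option (bool + aux) * direction)
}.

Definition cell (M : machine) : Type := option (bool + aux M).

(* [(l, r)]: [r] lists the cells from the scanned one rightwards, [l] the cells
   on its left starting with the nearest; all cells not listed are blank. *)
Definition tape (M : machine) : Type := (seq (cell M) * seq (cell M))%type.

Definition scanned (M : machine) (t : tape M) : cell M := head None t.2.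

Definition write (M : machine) (a : cell M) (t : tape M) : tape M :=
  (t.1, a :: behead t.2).

Definition move_head (M : machine) (d : direction) (t : tape M) : tape M :=
  match d with
  | GoLeft => (behead t.1, head None t.1 :: t.2)
  | Stay => t
  | GoRight => (head None t.2 :: t.1, behead t.2)
  end.

Definition config (M : machine) : Type :=
  (state M * ('I_(work_tapes M).+1 -> tape M))%type.

Definition step (M : machine) (c : config M) : config M :=
  if halting c.1 then c else
  let: (q, act) := trans c.1 (fun i => scanned (c.2 i)) in
  (q, fun i => move_head (act i).2 (write (act i).1 (c.2 i))).

Definition init (M : machine) (x : seq bool) : config M :=
  (start M,
   fun i => if i == ord0 then ([::], [seq Some (inl b) | b <- x])
            else ([::], [::])).

(* The output is the maximal bit string starting at the head of tape 0. *)
Fixpoint leading_bits (A : Type) (s : seq (option (bool + A))) : seq bool :=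
  if s is Some (inl b) :: s' then b :: leading_bits s' else [::].

Definition output (M : machine) (c : config M) : seq bool :=
  leading_bits (c.2 ord0).2.

(* Halting configurations are fixed by [step], so this says that the machine
   halts within [p.[size x]] steps with output [g x]. *)
Definition polytime (g : seq bool -> seq bool) : Prop :=
  exists (M : machine) (p : {poly nat}), forall x : seq bool,
    let c := iter (p.[size x])%R (@step M) (init M x) in
    halting c.1 /\ output c = g x.

(** * Self-delimiting binary encodings *)

Definition enc_seq (A : Type) (enc : A -> seq bool) (s : seq A) : seq bool :=
  flatten [seq true :: enc a | a <- s] ++ [:: false].

Definition enc_bits : seq bool -> seq bool := enc_seq (fun b => [:: b]).

(* Binary digits, least significant first; [bits 0] is empty. *)
Definition bits (n : nat) : seq bool :=
  mkseq (fun i => odd (n %/ 2 ^ i)) (up_log 2 n.+1).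

Definition enc_nat (n : nat) : seq bool := enc_bits (bits n).

Definition enc_rat (r : rat) : seq bool :=
  (r < 0)%R :: enc_nat `|numq r|%N ++ enc_nat `|denq r|%N.

Definition enc_pair (x y : seq bool) : seq bool := enc_bits x ++ y.

(** * NP and (strong) NP-hardness *)

Definition NP (L : seq bool -> Prop) : Prop :=
  exists (V : seq bool -> bool) (p : {poly nat}),
    polytime (fun z => [:: V z]) /\
    forall x, L x <->
      exists y, size y <= (p.[size x])%R /\ V (enc_pair x y).

(* [maxnum i] is the largest magnitude of a number occurring in [i]. *)
Record problem := Problem {
  instance : Type;
  encode : instance -> seq bool;
  maxnum : instance -> nat;
  valid : instance -> Prop;
  yes : instance -> Prop
}.

Definition restrict (Pi : problem) (Q : instance Pi -> Prop) : problem :=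
  @Problem (instance Pi) (@encode Pi) (@maxnum Pi)
    (fun i => valid i /\ Q i) (@yes Pi).

(* Polynomial-time many-one hardness; reductions only produce (encodings of)
   valid instances, so for a [restrict]ed problem the negative instances lie in
   the restricted class as well. *)
Definition NP_hard (Pi : problem) : Prop :=
  forall L : seq bool -> Prop, NP L ->
    exists g : seq bool -> instance Pi,
      polytime (fun x => encode (g x)) /\
      forall x, valid (g x) /\ (L x <-> yes (g x)).

(* Garey and Johnson: the problem stays NP-hard on the instances whose numbers
   are polynomially bounded in the length of the (binary) encoding. *)
Definition strongly_NP_hard (Pi : problem) : Prop :=
  exists p : {poly nat},
    NP_hard (restrict (fun i : instance Pi =>
                         maxnum i <= (p.[size (encode i)])%R)).

(** * Fare Zone Assignment *)

Record commodity (m : nat) := Commodity {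
  route : {set 'I_m};
  bound : nat;
  weight : nat
}.

(* Edges are designated by their position in [edges].  [fares] is the table of
   the values of the fare function at 0, ..., |E|, the only ones that a revenue
   can involve. *)
Record fza := Fza {
  nvert : nat;
  edges : seq ('I_nvert * 'I_nvert);
  fares : seq rat;
  commodities : seq (commodity (size edges));
  target : rat
}.

Definition edge (I : fza) (e : 'I_(size (edges I))) : 'I_(nvert I) * 'I_(nvert I) :=
  tnth (in_tuple (edges I)) e.

Definition adj (I : fza) : rel 'I_(nvert I) :=
  fun u v => ((u, v) \in edges I) || ((v, u) \in edges I).

(* Each edge is listed once, smaller endpoint first: the graph is simple. *)
Definition is_simple (I : fza) : Prop :=
  uniq (edges I) /\ all (fun e : 'I_(nvert I) * 'I_(nvert I) => e.1 < e.2) (edges I).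

Definition is_tree (I : fza) : Prop :=
  [/\ 0 < nvert I,
      is_simple I,
      forall u v, connect (@adj I) u v
    & forall c : seq 'I_(nvert I), 2 < size c -> ~ ucycle (@adj I) c].

Definition walk_edges (I : fza) (v : 'I_(nvert I)) (s : seq 'I_(nvert I)) :
    {set 'I_(size (edges I))} :=
  [set e | (edge e \in zip (v :: s) s) ||
           (((edge e).2, (edge e).1) \in zip (v :: s) s)].

Definition is_path (I : fza) (P : {set 'I_(size (edges I))}) : Prop :=
  exists (v : 'I_(nvert I)) (s : seq 'I_(nvert I)),
    [/\ path (@adj I) v s, uniq (v :: s) & P = walk_edges v s].

(* The table is continued by its last value, which preserves monotonicity and
   concavity, so as to have a function on all of nat. *)
Definition fare (I : fza) (k : nat) : rat :=
  nth (last 0%R (fares I)) (fares I) k.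

Definition is_fare_function (f : nat -> rat) : Prop :=
  [/\ forall k, (0 <= f k)%R,
      forall k, (f k <= f k.+1)%R
    & forall k, (f k + f k.+2 <= f k.+1 *+ 2)%R].

Definition fza_valid (I : fza) : Prop :=
  [/\ is_tree I,
      size (fares I) = (size (edges I)).+1,
      is_fare_function (fare I)
    & forall j : 'I_(size (commodities I)),
        let c := tnth (in_tuple (commodities I)) j in
        is_path (route c) /\ 0 < weight c].

Definition revenue (I : fza) (c : commodity (size (edges I)))
    (F : {set 'I_(size (edges I))}) : rat :=
  if #|route c :&: F| <= bound c
  then ((weight c)%:R * fare I #|route c :&: F|)%R
  else 0%R.

Definition fza_yes (I : fza) : Prop :=
  exists F : {set 'I_(size (edges I))},
    (target I <= \sum_(c <- commodities I) revenue c F)%R.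

(* A route is encoded by its characteristic vector. *)
Definition enc_commodity (m : nat) (c : commodity m) : seq bool :=
  [seq e \in route c | e <- enum 'I_m] ++ enc_nat (bound c) ++ enc_nat (weight c).

Definition fza_encode (I : fza) : seq bool :=
  enc_nat (nvert I)
  ++ enc_seq (fun e => enc_nat (val e.1) ++ enc_nat (val e.2)) (edges I)
  ++ enc_seq enc_rat (fares I)
  ++ enc_seq (@enc_commodity (size (edges I))) (commodities I)
  ++ enc_rat (target I).

Definition rat_height (r : rat) : nat := maxn `|numq r|%N `|denq r|%N.

Definition fza_maxnum (I : fza) : nat :=
  maxn (rat_height (target I))
    (maxn (\max_(r <- fares I) rat_height r)
          (\max_(c <- commodities I) maxn (bound c) (weight c))).

Definition FZA : problem := Problem fza_encode fza_maxnum fza_valid fza_yes.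

Definition tree_is_path (I : fza) : Prop :=
  is_path [set: 'I_(size (edges I))].

(* Main.v *)
(** Every language L in NP is reduced directly to fare zone assignment on a path, with
    the fare function min(k, 1).

    The existence of an accepted certificate is expressed by a tableau whose entry
    (t, o) records the state, the scanned symbols and the symbols at offset o from
    the heads at time t.  Since offsets are relative to the heads, all the conditions
    bear on one entry or on two neighbouring ones, also for several tapes.  One bit
    per entry and possible value turns this into: choose as many bits as there are
    entries, no two of them conflicting.

    On the path, such a bit x becomes a block of three edges used x, 1 - x and 1
    times; heavy tolls on the first two edges and on the third one, with bound 1,
    enforce this.  The number of used edges in an interval from the second edge of a
    block b to the first edge of a later block b' is then 2 (b' - b) + x' - x, so
    that the bound 2 (b' - b) - 1 yields the revenue x (1 - x'); together with the
    revenue 1 - x from the second edge of b this makes 1 - x x', which penalizes the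
    choice of two conflicting bits.  All weights are polynomial in the number of
    blocks.

    The encoding of the instance is written by a program made of nested loops with
    arithmetic expressions as bounds, whose values are automatically polynomial; it
    is run by a multi-tape machine that keeps its counters in unary, as head
    positions. *)
Require Import Defs.
From mathcomp Require Import all_boot all_order all_algebra.
From mathcomp Require Import zify.
From Stdlib Require Import FunctionalExtensionality.

Set Implicit Arguments.
Unset Strict Implicit.
Unset Printing Implicit Defensive.

(** * Counter programs and their compilation to Turing machines *)

(** Polynomial time is defined by explicit Turing machines, so a reduction has to be shown to write
    the whole encoding of its instance. A single reduction from an arbitrary verifier needs this
    once; a chain of reductions would also require composing machines and decoding intermediate
    instances. With the fare min(k, 1), a commodity of weight w and bound u pays w exactly when
    between 1 and u of its edges are used, so each commodity is a threshold test. The levels of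
    weights are separated by counting: a pair toll is worth N + 1, more than all N bits, and a block
    toll is worth more than 2 N^2 pair tolls and N bits together, so that reaching the target forces
    the levels one after the other. The verifier's input [enc_pair x y] begins with the bits of [x],
    each preceded by [true]. The machine stores this same doubled string, and the program reads the
    initial row of the tableau by plain indexing. All numbers are of polynomial value: this lets
    unary counters compute them, and it gives hardness in the strong sense. *)

Definition upd (s : nat -> nat) (i v j : nat) : nat := if j == i then v else s j.

Inductive base := Inc of nat | Dec of nat | Put of nat | Get of nat.

Inductive cmd := Base of base | Skip | Seq of cmd & cmd | Loop of nat & cmd.

Definition store : Type := (nat -> nat) * seq bool.

(* Counter 0 is also a pointer into the fixed bit string [z], its value [v]
   designating the bit of index [v - 1]. *)
Definition base_den (z : seq bool) (b : base) (st : store) : store :=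
  match b with
  | Inc i => (upd st.1 i (st.1 i).+1, st.2)
  | Dec i => (upd st.1 i (st.1 i).-1, st.2)
  | Put i => (st.1, rcons st.2 (st.1 i != 0))
  | Get i => (upd st.1 i (st.1 i + nth false (false :: z) (st.1 0)), st.2)
  end.

(** This is a relation because [Loop] is a while loop, whose body may refill its counter. The last
    index is the exact number of machine steps: a passed test and the jump back cost one step each,
    whence [.+2]. *)
Inductive exec (z : seq bool) : cmd -> store -> store -> nat -> Prop :=
| ExecBase b st : exec z (Base b) st (base_den z b st) 1
| ExecSkip st : exec z Skip st st 0
| ExecSeq c1 c2 st1 st2 st3 k1 k2 :
    exec z c1 st1 st2 k1 -> exec z c2 st2 st3 k2 ->
    exec z (Seq c1 c2) st1 st3 (k1 + k2)
| ExecLoop0 i c st : st.1 i = 0 -> exec z (Loop i c) st st 1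
| ExecLoopS i c st st1 st2 v k1 k2 :
    st.1 i = v.+1 -> exec z c (upd st.1 i v, st.2) st1 k1 ->
    exec z (Loop i c) st1 st2 k2 ->
    exec z (Loop i c) st st2 (k1 + k2).+2.

Inductive instr :=
| IBase of base | IJzd of nat & nat | IJmp of nat
| IMark | ICopyA of nat | ICopyB of nat | IRewind | IRewindLoop.

Fixpoint compile (c : cmd) (p : nat) : seq instr :=
  match c with
  | Base b => [:: IBase b]
  | Skip => [::]
  | Seq c1 c2 => let s := compile c1 p in s ++ compile c2 (p + size s)
  | Loop i c =>
      let s := compile c p.+1 in
      IJzd i (p + size s).+2 :: s ++ [:: IJmp p]
  end.

Definition base_below (K : nat) (b : base) : bool :=
  match b with Inc i | Dec i | Put i | Get i => i <= K end.

Fixpoint cmd_below (K : nat) (c : cmd) : bool :=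
  match c with
  | Base b => base_below K b
  | Skip => true
  | Seq c1 c2 => cmd_below K c1 && cmd_below K c2
  | Loop i c => (i <= K) && cmd_below K c
  end.

Lemma cmd_below_leq c K K' : K <= K' -> cmd_below K c -> cmd_below K' c.
Proof.
move=> le; elim: c => //= [[] i /=|c1 IH1 c2 IH2 /andP[/IH1-> /IH2->]|i c IH /andP[h /IH->]] //.
- by move/leq_trans; apply.
- by move/leq_trans; apply.
- by move/leq_trans; apply.
- by move/leq_trans; apply.
- by rewrite (leq_trans h).
Qed.

Lemma cmd_below_ex c : exists K, cmd_below K c.
Proof.
elim: c => [[] i||c1 [K1 h1] c2 [K2 h2]|i c [K h]] /=; try by [exists i | exists 0].
- exists (maxn K1 K2); rewrite (cmd_below_leq _ h1) ?leq_maxl //.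
  by rewrite (cmd_below_leq _ h2) ?leq_maxr.
- exists (maxn i K); rewrite leq_maxl (cmd_below_leq _ h) ?leq_maxr //.
Qed.

Notation sym := (option (bool + unit)).
Definition mark : sym := Some (inr tt).
Definition bit (b : bool) : sym := Some (inl b).

(** * Simulation of compiled code by a multi-tape machine *)

Section Machine.

Variable K : nat.

Definition action : Type := 'I_K.+2 -> sym * direction.

Definition keep (s : 'I_K.+2 -> sym) : action := fun i => (s i, Stay).

Definition shift (j : nat) (d : direction) (s : 'I_K.+2 -> sym) : action :=
  fun i => (s i, if i == j :> nat then d else Stay).

Definition is_zero (j : nat) (s : 'I_K.+2 -> sym) : bool := s (inord j.+1) == mark.

Definition istep (ins : instr) (p : nat) (s : 'I_K.+2 -> sym) : nat * action :=
  match ins with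
  | IBase (Inc j) => (p.+1, shift j.+1 GoRight s)
  | IBase (Dec j) => (p.+1, shift j.+1 (if is_zero j s then Stay else GoLeft) s)
  | IBase (Put j) =>
      (p.+1, fun i : 'I_K.+2 => if i == ord0 then (bit (~~ is_zero j s), GoRight) else (s i, Stay))
  | IBase (Get j) =>
      (p.+1, shift j.+1 (if s (inord 1) == bit true then GoRight else Stay) s)
  | IJzd j l => if is_zero j s then (l, keep s) else (p.+1, shift j.+1 GoLeft s)
  | IJmp l => (l, keep s)
  | IMark =>
      (p.+1, fun i : 'I_K.+2 => if i == ord0 then (s i, Stay)
                      else (mark, if val i == 1 then GoRight else Stay))
  | ICopyA l =>
      if s ord0 is Some (inl b)
      then (p.+1, fun i : 'I_K.+2 => if val i == 1 then (bit true, GoRight) else (s i, Stay))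
      else (l, keep s)
  | ICopyB l =>
      (l, fun i : 'I_K.+2 => if i == ord0 then (None, GoRight)
                   else if val i == 1 then (s ord0, GoRight) else (s i, Stay))
  | IRewind => (p.+1, shift 0 GoLeft s)
  | IRewindLoop =>
      if s ord0 is Some (inl b) then (p, shift 0 GoLeft s) else (p.+1, shift 0 GoRight s)
  end.

Variable code : seq instr.

Definition mach : machine :=
  @Machine K.+1 unit 'I_(size code).+1 ord0
    (fun q => val q == size code)
    (fun q s => let: (p, a) := istep (nth IRewind code q) q s in (inord p, a)).

Definition act (a : action) (T : 'I_K.+2 -> tape mach) : 'I_K.+2 -> tape mach :=
  fun i => @move_head mach (a i).2 (@write mach (a i).1 (T i)).

Lemma step_mach ins s1 s2 (T : 'I_K.+2 -> tape mach) :
  code = s1 ++ ins :: s2 ->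
  let: (p', a) := istep ins (size s1) (fun i => scanned (T i)) in
  @step mach ((inord (size s1) : state mach), T) =
  ((inord p' : state mach), act a T).
Proof.
set p := size s1 => ec; have lt : p < size code by rewrite ec size_cat /= addnS ltnS leq_addr.
have e : nat_of_ord (inord p : 'I_(size code).+1) = p by rewrite inordK // ltnW.
have -> : ins = nth IRewind code p by rewrite ec nth_cat ltnn subnn.
rewrite /step /= e ltn_eqF //.
by case: istep.
Qed.

(** The left part reaches back to the mark, so its size is the head position. The trailing blanks
    are cells made explicit when the head went beyond the content. *)
Definition tape_at (s : seq sym) (v : nat) (t : tape mach) : Prop :=
  (exists k, catrev t.1 t.2 = mark :: s ++ nseq k None) /\ size t.1 = v.

Lemma scanned_tape_at s v t : tape_at s v t -> scanned t = nth None (mark :: s) v.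
Proof.
case: t => l r [[k /= e] <-]; rewrite /scanned /= -nth0.
have -> : nth None (mark :: s) (size l) = nth None (mark :: s ++ nseq k None) (size l).
  case: (size l) => //= m; rewrite nth_cat nth_nseq if_same.
  by case: ltnP => // h; rewrite nth_default.
by rewrite -e catrevE nth_cat size_rev ltnn subnn.
Qed.

Lemma tape_at_stay s v t :
  tape_at s v t -> tape_at s v (@move_head mach Stay (@write mach (scanned t) t)).
Proof.
case: t => l r [[k /= e] h]; split=> //=; rewrite /scanned /=.
case: r e => [|a r] /= e; last by exists k.
exists k.+1; rewrite -addn1 nseqD catA -cat_cons -e.
by rewrite !catrevE cats0.
Qed.

Lemma tape_at_right s v t :
  tape_at s v t -> tape_at s v.+1 (@move_head mach GoRight (@write mach (scanned t) t)).
Proof. by case/tape_at_stay=> [[k e] <-]; split => //=; exists k. Qed.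

Lemma tape_at_left s v t :
  tape_at s v.+1 t -> tape_at s v (@move_head mach GoLeft (@write mach (scanned t) t)).
Proof.
case/tape_at_stay=> [[k]] /=; case: t.1 => //= a l e [<-]; split => //=.
by exists k.
Qed.

Definition output_at (o : seq bool) (t : tape mach) : Prop :=
  exists k k', t = ([seq bit b | b <- rev o] ++ nseq k None, nseq k' None).

Lemma output_at_stay o t :
  output_at o t -> output_at o (@move_head mach Stay (@write mach (scanned t) t)).
Proof.
case=> k [k' ->]; exists k, k'.-1.+1; rewrite /write /scanned /=.
by case: k'.
Qed.

Lemma output_at_put o b t :
  output_at o t -> output_at (rcons o b) (@move_head mach GoRight (@write mach (bit b) t)).
Proof.
case=> k [k' ->]; exists k, k'.-1; rewrite rev_rcons /write /=.
by case: k'.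
Qed.

Definition content (z : seq bool) (j : nat) : seq sym :=
  if j == 0 then [seq bit b | b <- z] else [::].

(* Tape 0 collects the output; the head of tape [j + 1] stands [st.1 j] cells to the
   right of a mark, and the cells following the mark of tape 1 carry [z]. *)
Definition represents (z : seq bool) (st : store) (T : 'I_K.+2 -> tape mach) : Prop :=
  output_at st.2 (T ord0) /\
  forall j, j <= K -> tape_at (content z j) (st.1 j) (T (inord j.+1)).

Lemma val_counter j : j <= K -> nat_of_ord (inord j.+1 : 'I_K.+2) = j.+1.
Proof. by move=> le; rewrite inordK. Qed.

(** The content consists of bits and blanks, so the mark is scanned only at position 0. *)
Lemma is_zeroE z st T j : represents z st T -> j <= K ->
  is_zero j (fun i => scanned (T i)) = (st.1 j == 0).
Proof.
case=> _ h le; rewrite /is_zero (scanned_tape_at (h j le)).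
case: (st.1 j) => //= v; rewrite /content; case: ifP => _; last by rewrite nth_nil.
case: (ltnP v (size z)) => hv; first by rewrite (nth_map false).
by rewrite nth_default ?size_map.
Qed.

Lemma represents_keep z st T : represents z st T ->
  represents z st (act (keep (fun i => scanned (T i))) T).
Proof.
by case=> h1 h2; split=> [|j le]; [exact: output_at_stay | apply: tape_at_stay; exact: h2].
Qed.

Lemma represents_shift z st T j d v :
  represents z st T -> j <= K ->
  tape_at (content z j) v
    (@move_head mach d (@write mach (scanned (T (inord j.+1))) (T (inord j.+1)))) ->
  represents z (upd st.1 j v, st.2)
    (act (shift j.+1 d (fun i => scanned (T i))) T).
Proof.
case=> h1 h2 le h3; split => [|i lei]; first exact: output_at_stay.
rewrite /act /shift /= val_counter // eqSS /upd; case: eqP => [->//|_].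
by apply: tape_at_stay; apply: h2.
Qed.

Lemma istep_base z b p st T : represents z st T -> base_below K b ->
  let: (p', a) := istep (IBase b) p (fun i => scanned (T i)) in
  p' = p.+1 /\
  represents z (base_den z b st) (act a T).
Proof.
move=> h; have [h1 h2] := h; case: b => j /= le; split=> //.
- by apply: represents_shift => //; apply: tape_at_right; apply: h2.
- apply: represents_shift => //; rewrite (is_zeroE h) //; have := h2 j le.
  by case: (st.1 j) => [|v] /=; [exact: tape_at_stay | exact: tape_at_left].
- rewrite (is_zeroE h) //; split=> [|i lei]; first exact: output_at_put.
  rewrite /act -val_eqE /= val_counter //=.
  by apply: tape_at_stay; apply: h2.
- apply: represents_shift => //.
  rewrite (scanned_tape_at (h2 0 (leq0n _))) /content eqxx.
  have -> : (nth None (mark :: [seq bit b | b <- z]) (st.1 0) == bit true) =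
            nth false (false :: z) (st.1 0).
    case: (st.1 0) => //= v; case: (ltnP v (size z)) => hv.
      by rewrite (nth_map false) //; case: (nth false z v).
    by rewrite !nth_default ?size_map.
  case: nth; rewrite ?addn1 ?addn0; first by apply: tape_at_right; apply: h2.
  by apply: tape_at_stay; apply: h2.
Qed.

(** The induction is on the execution rather than on the command, since a loop enters the same code
    again. The surrounding code is generalized because jump targets are absolute. *)
Lemma exec_machine z c st st' k :
  exec z c st st' k -> cmd_below K c ->
  forall pre post T, code = pre ++ compile c (size pre) ++ post ->
  represents z st T ->
  exists T', iter k (@step mach) ((inord (size pre) : state mach), T) =
      ((inord (size pre + size (compile c (size pre))) : state mach), T') /\
    represents z st' T'.
Proof.
elim=> {c st st' k}
  [b st|st|c1 c2 st1 st2 st3 k1 k2 _ IH1 _ IH2|i c st v0|i c st st1 st2 v k1 k2 v0 _ IH1 _ IH2].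
- move=> /= wf pre post T ec h.
  have := step_mach T ec; have := istep_base (size pre) h wf.
  by case: istep => p' a [-> h'] ->; eexists; rewrite addn1; split; first reflexivity.
- by move=> _ pre post T _ h; exists T; rewrite addn0.
- move=> /= /andP[wf1 wf2] pre post T ec h.
  have [|T1 [e1 h1]] := IH1 wf1 pre (compile c2 (size pre + size (compile c1 (size pre))) ++ post) T _ h.
    by rewrite ec -catA.
  have [|T2 [e2 h2]] := IH2 wf2 (pre ++ compile c1 (size pre)) post T1 _ h1.
    by rewrite ec size_cat -!catA.
  exists T2; split=> //.
  by rewrite addnC iterD e1 -size_cat e2 !size_cat addnA.
- move=> /= /andP[lei _] pre post T ec h.
  have := step_mach T ec; rewrite /= (is_zeroE h) // v0 /= => ->.
  eexists; split; last exact: represents_keep h.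
  by rewrite size_cat /= addn1 !addnS.
- move=> /= /andP[lei wf] pre post T ec h.
  have := step_mach T ec; rewrite /= (is_zeroE h) // v0 /=.
  set T1 := act _ _ => e1.
  have h1 : represents z (upd st.1 i v, st.2) T1.
    apply: represents_shift => //; apply: tape_at_left; rewrite -v0.
    by case: h => _; apply.
  set s := compile c (size pre).+1 in ec e1 *.
  set ins := IJzd _ _ in ec.
  have [|T2 [e2 h2]] := IH1 wf (rcons pre ins) (IJmp (size pre) :: post) T1 _ h1.
    by rewrite {1}ec size_rcons -/s -cats1 -!catA.
  rewrite size_rcons -/s in e2.
  have ec2 : code = (pre ++ ins :: s) ++ IJmp (size pre) :: post.
    by rewrite {1}ec /= -!catA.
  have := step_mach T2 ec2; rewrite /= size_cat /= addnS -addSn.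
  set T3 := act _ _ => e3.
  have h3 : represents z st1 T3 by exact: represents_keep h2.
  have [||T4 [e4 h4]] := IH2 _ pre post T3 _ h3; first by rewrite /= lei.
    by rewrite {1}ec.
  exists T4; split=> //; rewrite -!iterS.
  rewrite (_ : (k1 + k2).+2 = k2 + k1.+2); last by lia.
  by rewrite iterD [iter k1.+2 _ _]iterS iterSr e1 e2 e3 e4.
Qed.

End Machine.

Lemma iter_step_halted (M : machine) k m (c : config M) :
  halting (iter k (@step M) c).1 -> k <= m ->
  iter m (@step M) c = iter k (@step M) c.
Proof.
move=> h le; rewrite -(subnK le) iterD; move: (iter k _ c) h => c' h.
by elim: (m - k) => //= n ->; rewrite /step h.
Qed.

Lemma exec_output_size z c st st' k :
  exec z c st st' k -> size st'.2 <= size st.2 + k.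
Proof.
elim=> {c st st' k} [[] i st|st|c1 c2 s1 s2 s3 k1 k2 _ h1 _ h2|i c st _|i c s1 s2 s3 v k1 k2 _ _ /= h1 _ h2] /=;
  rewrite ?size_rcons; lia.
Qed.

Definition doubled (x : seq bool) : seq bool := flatten [seq [:: true; b] | b <- x].

Lemma size_doubled x : size (doubled x) = (size x).*2.
Proof. by elim: x => //= b x ->; rewrite doubleS. Qed.

(** * Moving the input to tape 1 and rewinding the output *)

Section Wrapping.

Variables (K : nat) (c : cmd).

(** [ICopyA] and [ICopyB] form a loop that erases an input bit and writes [true] and this bit on
    tape 1. The head of tape 1 ends just behind the copy, so counter 0 starts at 2 n + 1 and
    transmits the input length to the program. *)
Definition full_code : seq instr :=
  [:: IMark; ICopyA 3; ICopyB 1] ++ compile c 3 ++ [:: IRewind; IRewindLoop].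

Notation M := (mach K full_code).

Lemma scannedE (l r : seq sym) : @scanned M (l, r) = head None r.
Proof. by []. Qed.

Definition copy_state (done todo : seq bool) (T : 'I_K.+2 -> tape M) : Prop :=
  exists k k',
  [/\ T ord0 = (nseq k None, [seq bit b | b <- todo] ++ nseq k' None),
      T (inord 1) = (rev (mark :: [seq bit b | b <- done]), [::]) &
      forall j, 0 < j <= K -> tape_at [::] 0 (T (inord j.+1))].

Lemma val_inord1 : nat_of_ord (inord 1 : 'I_K.+2) = 1.
Proof. by rewrite inordK. Qed.

Lemma machine_init x : copy_state [::] x (@step M (init M x)).2.
Proof.
exists 0, (x == [::]); split.
- by case: x => // b x; rewrite cats0.
- rewrite /step /= /act /= -!val_eqE /= val_inord1 //=.
- move=> j /andP[j0 jK]; rewrite /step /= -!val_eqE /= val_counter //= eqSS gtn_eqF //.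
  by split=> //; exists 0.
Qed.

Lemma machine_copy x d T :
  copy_state d x T ->
  exists T', iter (size x).*2 (@step M) ((inord 1 : state M), T) =
      ((inord 1 : state M), T') /\ copy_state (d ++ doubled x) [::] T'.
Proof.
elim: x d T => [|b x IH] d T h; first by exists T; rewrite cats0.
have [k [k' [h0 h1 h2]]] := h.
pose T1 := act (istep (ICopyA 3) 1 (fun i => scanned (T i))).2 T.
pose T2 := act (istep (ICopyB 1) 2 (fun i => scanned (T1 i))).2 T1.
have e1 : @step M ((inord 1 : state M), T) = ((inord 2 : state M), T1).
  have ec : full_code = [:: IMark] ++ ICopyA 3 :: (ICopyB 1 :: compile c 3 ++ [:: IRewind; IRewindLoop]) by [].
  by have := step_mach T ec; rewrite /T1 /= h0 scannedE.
have e2 : @step M ((inord 2 : state M), T1) = ((inord 1 : state M), T2).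
  have ec : full_code = [:: IMark; ICopyA 3] ++ ICopyB 1 :: (compile c 3 ++ [:: IRewind; IRewindLoop]) by [].
  by have := step_mach T1 ec.
have [|T' [e3 h3]] := IH (d ++ [:: true; b]) T2.
  exists k.+1, k'; rewrite /T2 /T1 /act /=; split.
  - by rewrite h0.
  - rewrite h0 /= -!val_eqE /= val_inord1 /= h0 h1 /scanned /=.
    by rewrite map_cat -cat_cons rev_cat.
  - move=> j hj; have /andP[j0 jK] := hj.
    rewrite h0 /= -!val_eqE /= val_counter //= eqSS gtn_eqF //=.
    by apply: tape_at_stay; apply: tape_at_stay; apply: h2.
exists T'; split; last by rewrite -catA in h3.
by rewrite -[(size (b :: x)).*2]/(size x).*2.+2 !iterSr e1 e2 e3.
Qed.

Lemma machine_copied x T : copy_state x [::] T ->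
  let T' := act (keep (fun i => scanned (T i))) T in
  @step M ((inord 1 : state M), T) = ((inord 3 : state M), T') /\
  represents x (upd (fun=> 0) 0 (size x).+1, [::]) T'.
Proof.
move=> [k [k' [h0 h1 h2]]] /=; split.
  have ec : full_code = [:: IMark] ++ ICopyA 3 :: (ICopyB 1 :: compile c 3 ++ [:: IRewind; IRewindLoop]) by [].
  by have := step_mach T ec; rewrite /= h0 scannedE; case: (k').
apply: (@represents_keep _ _ x (upd (fun=> 0) 0 (size x).+1, [::])); split.
  by exists k, k'; rewrite h0.
case=> [|j] le; rewrite /content /upd /=; last by apply: h2.
rewrite h1; split; last by rewrite size_rev /= size_map.
by exists 0; rewrite /= catrevE revK !cats0.
Qed.

(** [o1] is the output up to the scanned cell, [o2] what has been passed already. The loop stops at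
    the blank before [o1], which is an erased input cell or a cell never visited. *)
Lemma machine_rewind_loop o1 o2 p k k' (T : 'I_K.+2 -> tape M) :
  (exists s1, full_code = s1 ++ [:: IRewindLoop] /\ p = size s1) ->
  T ord0 = @move_head M GoLeft ([seq bit b | b <- rev o1] ++ nseq k None,
                [seq bit b | b <- o2] ++ nseq k' None) ->
  exists T' k'', iter (size o1).+1 (@step M) ((inord p : state M), T) =
      ((inord p.+1 : state M), T') /\
    (T' ord0).2 = [seq bit b | b <- o1 ++ o2] ++ nseq k'' None.
Proof.
move=> [s1 [ec ep]]; elim/last_ind: o1 o2 T => [|o1 b IH] o2 T h.
  exists (act (shift 0 GoRight (fun i => scanned (T i))) T), k'; split.
    have := step_mach T ec; rewrite /= h -ep.
    by case: k {h} => [|k]; rewrite scannedE.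
  by rewrite /act /= h /write /=; case: k {h}.
pose T1 := act (shift 0 GoLeft (fun i => scanned (T i))) T.
have e1 : @step M ((inord p : state M), T) = ((inord p : state M), T1).
  by have := step_mach T ec; rewrite /= h -ep rev_rcons scannedE /=.
have [|T' [k'' [e2 h2]]] := IH (b :: o2) T1.
  by rewrite /T1 /act /= h rev_rcons /=.
exists T', k''; rewrite size_rcons iterSr e1 e2; split=> //.
by rewrite h2 cat_rcons.
Qed.

Lemma machine_full x st k :
  cmd_below K c ->
  exec (doubled x) c (upd (fun=> 0) 0 (size x).*2.+1, [::]) st k ->
  let cf := iter ((size x).*2 + k + size st.2 + 4) (@step M) (init M x) in
  halting cf.1 /\ output cf = st.2.
Proof.
move=> wf ex.
have h0 := machine_init x.
have [T1 [e1 h1]] := machine_copy h0.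
have /= [e2 h2] := machine_copied h1.
rewrite size_doubled in h2.
set T2 := act _ _ in e2 h2.
have [|T3 [e3 [h3 _]]] := exec_machine ex wf (pre := [:: IMark; ICopyA 3; ICopyB 1])
  (post := [:: IRewind; IRewindLoop]) (T := T2) _ h2; first by [].
have [k1 [k2 h3']] := h3.
set p := size _ + _ in e3.
pose T4 := act (shift 0 GoLeft (fun i => scanned (T3 i))) T3.
have e4 : @step M ((inord p : state M), T3) = ((inord p.+1 : state M), T4).
  have ec : full_code = ([:: IMark; ICopyA 3; ICopyB 1] ++ compile c 3) ++ IRewind :: [:: IRewindLoop].
    by rewrite -catA.
  by have := step_mach T3 ec; rewrite size_cat.
have [||T5 [k3 [e5 h5]]] := @machine_rewind_loop st.2 [::] p.+1 k1 k2.-1.+1 T4.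
- exists (([:: IMark; ICopyA 3; ICopyB 1] ++ compile c 3) ++ [:: IRewind]).
  by rewrite !size_cat /= addn1 -!catA.
- by rewrite /T4 /act /= h3' /write /=; case: (k2).
have e0 : @step M (init M x) = ((inord 1 : state M), (@step M (init M x)).2).
  have ec : full_code = [::] ++ IMark :: (behead full_code) by [].
  have := step_mach (init M x).2 ec; simpl size => e.
  have {1 2}-> : init M x = ((inord 0 : state M), (init M x).2).
    by congr pair; apply/val_inj; rewrite /= inordK.
  by rewrite e.
(* Marking, copying, leaving the copy loop, running [c], stepping left and rewinding take 1, 2 n, 1,
   k, 1 and [(size st.2).+1] steps. *)
rewrite (_ : _ + 4 = (size st.2).+1 + (1 + (k + (1 + ((size x).*2 + 1))))); last by lia.
have iter1 (A : Type) (g : A -> A) a : iter 1 g a = g a by [].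
rewrite !iterD !iter1 e0 e1 e2 e3 e4 e5 /=; split.
  by rewrite /p inordK // !size_cat /= addn2.
rewrite /output [X in leading_bits X]h5 cats0.
by elim: st.2 => [|b s /= ->]; case: (k3).
Qed.

End Wrapping.

Lemma cmd_polytime c (f : seq bool -> seq bool) e :
  (forall x, exists s k, k <= (size x + 2) ^ e /\
     exec (doubled x) c (upd (fun=> 0) 0 (size x).*2.+1, [::]) (s, f x) k) ->
  polytime f.
Proof.
move=> h; have [K wf] := cmd_below_ex c.
exists (mach K (full_code c)), (('X + 2%:R) ^+ (e + 4))%R => x.
have [s [k [le ex]]] := h x.
have [h1 h2] := machine_full wf ex.
have lex : k + k + (size x + 2) * 2 <= (size x + 2) ^ (e + 4).
  rewrite expnD; set a := _ ^ e in le *.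
  have a0 : 0 < a by rewrite expn_gt0 addn2.
  rewrite !expnS expn0; nia.
have -> : (('X + 2%:R) ^+ (e + 4)).[size x]%R = (size x + 2) ^ (e + 4).
  rewrite horner_exp hornerD hornerX -[2%:R%R]polyC_natr hornerC.
  by rewrite -natrXE.
rewrite (@iter_step_halted _ _ _ _ h1) //.
have := exec_output_size ex => /= hs.
by apply: leq_trans lex; move: hs le; set a := _ ^ e; rewrite -addnn; lia.
Qed.

(** * A language of polynomial-time string expressions *)

(** Single powers on m > 1 absorb constants and are stable under sums, products and substitution of
    a power, which is all that nested loops require. *)
Definition poly_bounded (f : nat -> nat) : Prop :=
  exists k, forall m, 1 < m -> f m <= m ^ k.

Lemma poly_bounded_const c : poly_bounded (fun=> c).
Proof. by exists c => m m1; apply: ltnW; apply: ltn_expl. Qed.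

Lemma poly_bounded_id : poly_bounded id.
Proof. by exists 1. Qed.

Lemma poly_boundedM f g :
  poly_bounded f -> poly_bounded g -> poly_bounded (fun m => f m * g m).
Proof.
by case=> [a ha] [b hb]; exists (a + b) => m m1; rewrite expnD leq_mul ?ha ?hb.
Qed.

Lemma poly_boundedD f g :
  poly_bounded f -> poly_bounded g -> poly_bounded (fun m => f m + g m).
Proof.
case=> [a ha] [b hb]; exists (a + b).+1 => m m1.
have := ha m m1; have := hb m m1; rewrite expnS expnD.
have : 0 < m ^ a by rewrite expn_gt0 ltnW.
have : 0 < m ^ b by rewrite expn_gt0 ltnW.
move: (m ^ a) (m ^ b) => x y y0 x0 gy fx.
have xy : x + y <= 2 * (x * y) by nia.
by apply: leq_trans (leq_add fx gy) (leq_trans xy _); rewrite leq_mul2r m1 orbT.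
Qed.

Lemma poly_bounded_pow f a :
  poly_bounded f -> poly_bounded (fun m => f (m ^ a.+1)).
Proof.
case=> [k hk]; exists (a.+1 * k) => m m1; rewrite expnM; apply: hk.
by rewrite -(exp1n a.+1) ltn_exp2r.
Qed.

Ltac poly_bounded_tac :=
  repeat first
    [ assumption | exact: poly_bounded_id | exact: poly_bounded_const
    | apply: poly_boundedD | apply: poly_boundedM ].

Definition runs (z : seq bool) (c : cmd) (st st' : store) (b : nat) : Prop :=
  exists k, k <= b /\ exec z c st st' k.

Lemma runs_weaken z c st st' b b' : b <= b' -> runs z c st st' b -> runs z c st st' b'.
Proof. by move=> le [k [h1 h2]]; exists k; split=> //; apply: leq_trans le. Qed.

Lemma runs_eq z c st o s s' b :
  runs z c st (s, o) b -> s = s' -> runs z c st (s', o) b.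
Proof. by move=> h <-. Qed.

Lemma runs_eq' z c o s s' st b :
  runs z c (s, o) st b -> s = s' -> runs z c (s', o) st b.
Proof. by move=> h <-. Qed.

Lemma runs_seq z c1 c2 st1 st2 st3 b1 b2 :
  runs z c1 st1 st2 b1 -> runs z c2 st2 st3 b2 -> runs z (Seq c1 c2) st1 st3 (b1 + b2).
Proof.
move=> [k1 [h1 e1]] [k2 [h2 e2]]; exists (k1 + k2); split; first exact: leq_add.
exact: ExecSeq e1 e2.
Qed.

Lemma runs_base z b st st' : base_den z b st = st' -> runs z (Base b) st st' 1.
Proof. by move=> <-; exists 1; split=> //; apply: ExecBase. Qed.

Lemma runs_skip z st : runs z Skip st st 0.
Proof. by exists 0; split=> //; apply: ExecSkip. Qed.

(** The sequence [st] plays the role of the loop invariant. It covers only loops whose body leaves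
    the loop counter at the decremented value. *)
Lemma runs_loop z i c (st : nat -> store) n b :
  (forall j, j <= n -> (st j).1 i = n - j) ->
  (forall j, j < n -> runs z c (upd (st j).1 i (n - j.+1), (st j).2) (st j.+1) b) ->
  runs z (Loop i c) (st 0) (st n) (n * b.+2).+1.
Proof.
elim: n st => [|n IH] st h1 h2.
  by exists 1; split=> //; apply: ExecLoop0; apply: h1.
have [|j jn|k [lek ek]] := IH (st \o S); first by move=> j jn; apply: h1.
  by apply: h2.
have [k1 [lek1 ek1]] := h2 0 isT.
exists (k1 + k).+2; split; last first.
  by apply: (ExecLoopS _ ek1 ek); rewrite h1 // subn0 subn1.
by rewrite mulSn; lia.
Qed.

Lemma updE s i v j : upd s i v j = if j == i then v else s j.
Proof. by []. Qed.

Ltac upd_solve :=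
  rewrite /=; try congr pair;
  try (apply: functional_extensionality => ? /=); rewrite !updE /=;
  repeat (case: eqP => ? /=); subst; try lia.

Ltac upd_case := rewrite /= !updE; repeat (case: eqP => ?); try lia.

Lemma runs_transfer z s o i d :
  i != d ->
  runs z (Loop i (Base (Inc d))) (s, o) (upd (upd s i 0) d (s d + s i), o) (s i * 3).+1.
Proof.
move=> id.
have := @runs_loop z i (Base (Inc d))
  (fun j => (upd (upd s i (s i - j)) d (s d + j), o)) (s i) 1.
rewrite subn0 subnn addn0 (_ : upd (upd s i (s i)) d (s d) = s); last by upd_solve.
apply=> [j _|j lt] /=; first by rewrite !updE eqxx (negbTE id).
by apply: runs_base; upd_solve.
Qed.

Lemma runs_drop z s o i d :
  i != d ->
  runs z (Loop i (Base (Dec d))) (s, o) (upd (upd s i 0) d (s d - s i), o) (s i * 3).+1.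
Proof.
move=> id.
have := @runs_loop z i (Base (Dec d))
  (fun j => (upd (upd s i (s i - j)) d (s d - j), o)) (s i) 1.
rewrite !subn0 subnn (_ : upd (upd s i (s i)) d (s d) = s); last by upd_solve.
apply=> [j _|j lt] /=; first by rewrite !updE eqxx (negbTE id).
by apply: runs_base; upd_solve.
Qed.

Lemma runs_clear z s o i :
  runs z (Loop i Skip) (s, o) (upd s i 0, o) (s i * 2).+1.
Proof.
have := @runs_loop z i Skip (fun j => (upd s i (s i - j), o)) (s i) 0.
rewrite !subn0 subnn (_ : upd s i (s i) = s); last by upd_solve.
apply=> [j _|j lt] /=; first by rewrite !updE eqxx.
rewrite (_ : upd _ _ _ = upd s i (s i - j.+1)); first exact: runs_skip.
by upd_solve.
Qed.

Definition copy (i d t : nat) : cmd :=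
  Seq (Loop i (Seq (Base (Inc d)) (Base (Inc t)))) (Loop t (Base (Inc i))).

Lemma runs_copy z s o i d t :
  i != d -> i != t -> d != t -> s t = 0 ->
  runs z (copy i d t) (s, o) (upd s d (s d + s i), o) (s i * 7 + 2).
Proof.
move=> id it dt t0.
apply: (@runs_weaken _ _ _ _ ((s i * 4).+1 + (s i * 3).+1)); first by lia.
apply: (@runs_seq _ _ _ _ (upd (upd (upd s i 0) d (s d + s i)) t (s i), o)).
  have := @runs_loop z i (Seq (Base (Inc d)) (Base (Inc t)))
    (fun j => (upd (upd (upd s i (s i - j)) d (s d + j)) t j, o)) (s i) 2.
  rewrite !subn0 subnn addn0.
  rewrite (_ : upd (upd (upd s i (s i)) d (s d)) t 0 = s); last by upd_solve.
  apply=> [j _|j lt] /=; first by rewrite !updE eqxx (negbTE id) (negbTE it).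
  by apply: (@runs_seq _ _ _ _ _ _ 1 1); apply: runs_base; first reflexivity; upd_solve.
set s' := upd _ _ _.
have := @runs_transfer z s' o t i; rewrite eq_sym => /(_ it).
rewrite /s' !updE eqxx (negbTE it) (negbTE id) eqxx add0n => h.
congr (runs _ _ _ _ _): h; congr pair.
by upd_solve.
Qed.

Inductive exp :=
| Var of nat | Cst of nat | Add of exp & exp | Mul of exp & exp | Monus of exp & exp
| Bit of exp.

(* Variables are de Bruijn levels. *)
Fixpoint ev (z : seq bool) (r : seq nat) (e : exp) : nat :=
  match e with
  | Var l => nth 0 r l
  | Cst c => c
  | Add a b => ev z r a + ev z r b
  | Mul a b => ev z r a * ev z r b
  | Monus a b => ev z r a - ev z r b
  | Bit a => nth false z (ev z r a)
  end.

(* The variable of level [l] is held in counter [2 l + 1]; the counters from [d]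
   on are available, and the value is left in counter [d]. *)
Fixpoint cexp (s : nat) (e : exp) (d : nat) : cmd :=
  match e with
  | Var l => if l < s then copy l.*2.+1 d d.+1 else Skip
  | Cst c => iter c (Seq (Base (Inc d))) Skip
  | Add a b =>
      Seq (cexp s a d) (Seq (cexp s b d.+1) (Loop d.+1 (Base (Inc d))))
  | Mul a b =>
      Seq (cexp s a d.+1) (Seq (cexp s b d.+2)
        (Seq (Loop d.+1 (copy d.+2 d d.+3)) (Loop d.+2 Skip)))
  | Monus a b =>
      Seq (cexp s a d) (Seq (cexp s b d.+1) (Loop d.+1 (Base (Dec d))))
  | Bit a =>
      Seq (cexp s a d) (Seq (Loop d (Base (Inc 0)))
        (Seq (Base (Inc 0)) (Seq (Base (Get d)) (Loop 0 Skip))))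
  end.

Record env_ok (r : seq nat) (d : nat) (s : nat -> nat) : Prop := EnvOk {
  env_depth : (size r).*2 <= d;
  env_ptr : s 0 = 0;
  env_var : forall l, l < size r -> s l.*2.+1 = nth 0 r l;
  env_free : forall j, d <= j -> s j = 0
}.

Lemma env_ok_upd r d s v : 0 < size r -> env_ok r d s -> env_ok r d.+1 (upd s d v).
Proof.
move=> r0 [h1 h2 h3 h4]; split; first exact: leqW.
- by rewrite updE eq_sym gtn_eqF //; lia.
- by move=> l hl; rewrite updE ltn_eqF ?h3 //; lia.
- by move=> j hj; rewrite updE gtn_eqF // h4 // ltnW.
Qed.

(** Value and running time are bounded together, since a unary counter makes the cost of an
    operation depend on the size of its operands. The bound depends only on [m], which dominates all
    the variables. *)
Lemma cexp_correct e :
  exists f, poly_bounded f /\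
  forall z r d s o m, 1 < m -> 0 < size r -> all (leq^~ m) r -> env_ok r d s ->
    ev z r e <= f m /\ runs z (cexp (size r) e d) (s, o) (upd s d (ev z r e), o) (f m).
Proof.
elim: e => [l|c|a [f [pf IHa]] b [g [pg IHb]]|a [f [pf IHa]] b [g [pg IHb]]
           |a [f [pf IHa]] b [g [pg IHb]]|a [f [pf IHa]]].
- exists (fun m => m * 7 + 2); split.
    by apply: poly_boundedD (poly_bounded_const _); apply: poly_boundedM (poly_bounded_const _);
      apply: poly_bounded_id.
  move=> z r d s o m m1 r0 rm [h1 h2 h3 h4].
  have vm : nth 0 r l <= m.
    by case: (ltnP l (size r)) => hl; [apply: (allP rm); apply: mem_nth | rewrite nth_default].
  split=> /=; first by lia.
  case: ltnP => hl; last first.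
    rewrite nth_default // (_ : upd s d 0 = s); last by upd_solve; rewrite h4.
    by apply: runs_weaken (runs_skip _ _).
  have := @runs_copy z s o l.*2.+1 d d.+1; rewrite h3 // (h4 d) // add0n => h.
  by apply: runs_weaken (h _ _ _ _); rewrite ?h4 //; lia.
- exists (fun=> c); split; first exact: poly_bounded_const.
  move=> z r d s o m m1 r0 rm [h1 h2 h3 h4]; split=> //=.
  have -> : upd s d c = upd s d (s d + c) by rewrite h4.
  elim: c s {h1 h2 h3 h4} => [|c IH] s /=.
    rewrite addn0 (_ : upd _ _ _ = s); first exact: runs_skip.
    by upd_solve.
  apply: (@runs_seq _ _ _ _ _ _ 1); first by apply: runs_base; reflexivity.
  have := IH (upd s d (s d).+1); rewrite updE eqxx addSnnS.
  by rewrite (_ : upd (upd _ _ _) _ _ = upd s d (s d + c.+1)) //; upd_solve.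
- exists (fun m => f m + (g m + (g m * 3 + 1))); split; first by poly_bounded_tac.
  move=> z r d s o m m1 r0 rm h; have [h1 h2 h3 h4] := h.
  have [la ra] := IHa z r d s o m m1 r0 rm h.
  have [lb rb] := IHb z r d.+1 _ o m m1 r0 rm (env_ok_upd (ev z r a) r0 h).
  split=> /=; first by lia.
  apply: runs_seq ra _; apply: runs_seq rb _.
  apply: runs_weaken (runs_eq (@runs_transfer z _ o d.+1 d _) _); first by rewrite updE eqxx; lia.
    by lia.
  by upd_solve; rewrite h4.
- exists (fun m => f m + (g m + (f m * (g m * 7 + 4) + 1 + (g m * 2 + 1)))); split; first by poly_bounded_tac.
  move=> z r d s o m m1 r0 rm h; have [h1 h2 h3 h4] := h.
  have h' : env_ok r d.+1 s by split=> // [|j /ltnW/h4]; first exact: leqW.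
  have [la ra] := IHa z r d.+1 s o m m1 r0 rm h'.
  have [lb rb] := IHb z r d.+2 _ o m m1 r0 rm (env_ok_upd (ev z r a) r0 h').
  set A := ev z r a in la ra rb *; set B := ev z r b in lb rb *.
  have AB : A * B <= f m * g m by exact: leq_mul.
  split=> /=; first by nia.
  apply: runs_seq ra _; apply: runs_seq rb _.
  (* After j rounds, counter d has accumulated j copies of B; the operands are kept in the two
     counters above. *)
  pose S j := upd (upd (upd s d.+1 (A - j)) d.+2 B) d (j * B).
  apply: (@runs_seq _ _ _ _ (S A, o)).
    have := @runs_loop z d.+1 (copy d.+2 d d.+3) (fun j => (S j, o)) A (B * 7 + 2).
    rewrite /S subn0 mul0n => hl.
    apply: runs_weaken (runs_eq' (hl _ _) _); first by nia.
    - by move=> j _; upd_case.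
    - move=> j jA /=; apply: runs_weaken (runs_eq (@runs_copy z _ o d.+2 d d.+3 _ _ _ _) _); try by lia.
      + by upd_case.
      + by upd_case; apply: h4; lia.
      + by upd_solve.
    - by upd_solve; rewrite h4.
  apply: runs_weaken (runs_eq (@runs_clear z _ o d.+2) _).
    by rewrite /S; upd_case.
  by rewrite /S; upd_solve; rewrite ?subnn h4 //; lia.
- exists (fun m => f m + (g m + (g m * 3 + 1))); split; first by poly_bounded_tac.
  move=> z r d s o m m1 r0 rm h; have [h1 h2 h3 h4] := h.
  have [la ra] := IHa z r d s o m m1 r0 rm h.
  have [lb rb] := IHb z r d.+1 _ o m m1 r0 rm (env_ok_upd (ev z r a) r0 h).
  split=> /=; first by lia.
  apply: runs_seq ra _; apply: runs_seq rb _.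
  apply: runs_weaken (runs_eq (@runs_drop z _ o d.+1 d _) _); first by rewrite updE eqxx; lia.
    by lia.
  by upd_solve; rewrite h4.
- exists (fun m => f m + ((f m * 3 + 1) + (1 + (1 + (f m * 2 + 3)))) ); split; first by poly_bounded_tac.
  move=> z r d s o m m1 r0 rm h; have [h1 h2 h3 h4] := h.
  have [la ra] := IHa z r d s o m m1 r0 rm h.
  split=> /=; first by case: nth; lia.
  set A := ev z r a in la ra *.
  have d0 : d != 0 by lia.
  apply: runs_seq ra _.
  apply: (@runs_seq _ _ _ _ (upd (upd s d 0) 0 A, o)).
    apply: runs_weaken (runs_eq (@runs_transfer z _ o d 0 d0) _); first by rewrite updE eqxx; lia.
    by upd_solve; rewrite h2.
  (* At value 0 the pointer is on the mark, so the bit of index A is found at A + 1. *)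
  apply: (@runs_seq _ _ _ _ (upd (upd s d 0) 0 A.+1, o)).
    by apply: runs_base; upd_solve.
  apply: (@runs_seq _ _ _ _ (upd (upd s d (nth false z A)) 0 A.+1, o)).
    by apply: runs_base; upd_solve; rewrite eqxx.
  apply: runs_weaken (runs_eq (@runs_clear z _ o 0) _).
    by rewrite updE eqxx; lia.
  by upd_solve; rewrite h2.
Qed.
Inductive prog :=
| PNil | PBit of exp | PNat of exp | PSeq of prog & prog | PFor of exp & prog.

Fixpoint pv (z : seq bool) (r : seq nat) (p : prog) : seq bool :=
  match p with
  | PNil => [::]
  | PBit e => [:: ev z r e != 0]
  | PNat e => enc_nat (ev z r e)
  | PSeq p q => pv z r p ++ pv z r q
  | PFor e p => flatten [seq pv z (rcons r i) p | i <- iota 0 (ev z r e)]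
  end.

(** Counter d + 1 holds the parity of the units consumed so far. A loop over its former value, 0 or
    1, serves as a conditional: on every second unit it resets the parity and increments the
    quotient in d + 3. *)
Definition halve (d : nat) : cmd :=
  Loop d (Seq (Loop d.+1 (Base (Inc d.+2))) (Seq (Base (Inc d.+1))
    (Loop d.+2 (Seq (Base (Dec d.+1)) (Base (Inc d.+3)))))).

(** The first [Inc] undoes the decrement made by the loop test. Each round emits the continuation
    bit [true] and the lowest digit, then refills d with the half; the last [Put] meets the value 0
    and emits the end marker [false]. *)
Definition put_nat (d : nat) : cmd :=
  Seq (Loop d (Seq (Base (Inc d)) (Seq (Base (Put d)) (Seq (halve d)
    (Seq (Base (Put d.+1)) (Seq (Loop d.+1 Skip) (Loop d.+3 (Base (Inc d)))))))))
    (Base (Put d)).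

Fixpoint cprog (s : nat) (p : prog) : cmd :=
  match p with
  | PNil => Skip
  | PBit e => Seq (cexp s e s.*2) (Seq (Base (Put s.*2)) (Loop s.*2 Skip))
  | PNat e => Seq (cexp s e s.*2) (Seq (put_nat s.*2) (Loop s.*2 Skip))
  | PSeq p q => Seq (cprog s p) (cprog s q)
  | PFor e p =>
      Seq (cexp s e s.*2)
        (Seq (Loop s.*2 (Seq (cprog s.+1 p) (Base (Inc s.*2.+1)))) (Loop s.*2.+1 Skip))
  end.

Lemma enc_nat_half n : 0 < n -> enc_nat n = [:: true, odd n & enc_nat n./2].
Proof.
move=> n0; rewrite /enc_nat; suff -> : bits n = odd n :: bits n./2 by [].
rewrite /bits up_log2S // /mkseq /= expn0 divn1 [iota 1 _](iotaDl 1 0) -map_comp.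
by congr cons; apply: eq_map => i /=; rewrite expnD divnMA -divn2.
Qed.

Lemma runs_halve z s o d :
  s d.+1 = 0 -> s d.+2 = 0 -> s d.+3 = 0 ->
  runs z (halve d) (s, o) (upd (upd (upd s d 0) d.+1 (odd (s d))) d.+3 (s d)./2, o)
    (s d * 15).+1.
Proof.
move=> h1 h2 h3.
have := @runs_loop z d (Seq (Loop d.+1 (Base (Inc d.+2))) (Seq (Base (Inc d.+1))
    (Loop d.+2 (Seq (Base (Dec d.+1)) (Base (Inc d.+3))))))
   (fun j => (upd (upd (upd s d (s d - j)) d.+1 (odd j)) d.+3 j./2, o)) (s d) 13.
rewrite /= subn0 subnn => h.
apply: runs_eq' (h _ _) _; last by upd_solve; rewrite ?h1 ?h3.
  by move=> j _; upd_case.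
move=> j jd; set s1 := upd _ _ _.
apply: (@runs_weaken _ _ _ _ (4 + (1 + 8))) => //.
apply: (@runs_seq _ _ _ _ (upd (upd s1 d.+1 0) d.+2 (odd j), o)).
  apply: runs_weaken (runs_eq (@runs_transfer z s1 o d.+1 d.+2 _) _); try by lia.
    by rewrite /s1; upd_case; case: odd.
  by rewrite /s1; upd_solve; rewrite h2.
apply: (@runs_seq _ _ _ _ (upd (upd s1 d.+1 1) d.+2 (odd j), o)).
  by apply: runs_base; upd_solve.
have := @runs_loop z d.+2 (Seq (Base (Dec d.+1)) (Base (Inc d.+3)))
   (fun i => (upd (upd (upd s1 d.+1 (1 - i)) d.+2 (odd j - i)) d.+3 (j./2 + i), o)) (odd j) 2.
rewrite subn0 subnn addn0 => {}h.
apply: runs_weaken (runs_eq (runs_eq' (h _ _) _) _).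
- by case: odd.
- by move=> i _; upd_case.
- move=> i lt; apply: (@runs_seq _ _ _ _ _ _ 1 1); apply: runs_base; first reflexivity.
  by upd_solve.
- by rewrite /s1; upd_solve.
- by rewrite /s1; upd_solve; rewrite /= ?h2 //; rewrite ?uphalf_half; case: odd.
Qed.

Lemma exec_seq_inv z c1 c2 st st' k :
  exec z (Seq c1 c2) st st' k ->
  exists st1 k1 k2, [/\ exec z c1 st st1 k1, exec z c2 st1 st' k2 & k = k1 + k2].
Proof. by move=> h; inversion h; subst; eexists; eexists; eexists; split; eauto. Qed.

(** The loop refills its counter, so [runs_loop] does not apply and the induction is on the value.
    The number of rounds is bounded by the value itself: halving a positive number lowers it by at
    least one, which pays for one round. *)
Lemma runs_put_nat z s o d m :
  s d <= m -> s d.+1 = 0 -> s d.+2 = 0 -> s d.+3 = 0 ->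
  runs z (put_nat d) (s, o) (upd s d 0, o ++ enc_nat (s d)) (m * (m * 20 + 20) + 2).
Proof.
move=> le h1 h2 h3.
apply: (@runs_weaken _ _ _ _ (s d * (m * 20 + 20) + 1 + 1)).
  by have := leq_mul le (leqnn (m * 20 + 20)); lia.
have [n] := ubnP (s d); elim: n s o le h1 h2 h3 => // n IH s o le h1 h2 h3 ln.
case: (posnP (s d)) => d0.
  rewrite d0; apply: (@runs_seq _ _ _ _ (s, o)).
    by exists 1; split=> //; apply: ExecLoop0.
  by apply: runs_base => /=; rewrite d0 cats1; upd_solve.
set s1 := upd s d (s d)./2.
have [|||||k [lek ek]] := IH s1 ((o ++ [:: true]) ++ [:: odd (s d)]).
- by rewrite /s1 updE eqxx; lia.
- by rewrite /s1; upd_case.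
- by rewrite /s1; upd_case.
- by rewrite /s1; upd_case.
- by rewrite /s1 updE eqxx; lia.
have s1d : s1 d = (s d)./2 by rewrite /s1 updE eqxx.
rewrite s1d -!catA /= -enc_nat_half // in lek ek.
have [k1 [lek1 ek1]] : runs z (Seq (Base (Inc d)) (Seq (Base (Put d)) (Seq (halve d)
    (Seq (Base (Put d.+1)) (Seq (Loop d.+1 Skip) (Loop d.+3 (Base (Inc d))))))))
    (upd s d (s d).-1, o) (s1, (o ++ [:: true]) ++ [:: odd (s d)])
    (1 + (1 + ((s d * 15).+1 + (1 + (3 + ((s d)./2 * 3).+1))))).
  apply: (@runs_seq _ _ _ _ (s, o)); first by apply: runs_base; upd_solve.
  apply: (@runs_seq _ _ _ _ (s, o ++ [:: true])).
    by apply: runs_base; rewrite /= -lt0n d0 cats1.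
  apply: runs_seq (runs_halve _ _ h1 h2 h3) _.
  apply: (@runs_seq _ _ _ _ (upd (upd (upd s d 0) d.+1 (odd (s d))) d.+3 (s d)./2,
     (o ++ [:: true]) ++ [:: odd (s d)])).
    apply: runs_base; rewrite /= !cats1; congr (_, rcons _ _).
    rewrite (_ : upd _ _ _ _ = odd (s d)); first by case: odd.
    by upd_case.
  apply: (@runs_seq _ _ _ _ (upd (upd s d 0) d.+3 (s d)./2,
     (o ++ [:: true]) ++ [:: odd (s d)])).
    apply: runs_weaken (runs_eq (@runs_clear z _ _ d.+1) _).
      by upd_case; case: odd.
    by upd_solve.
  apply: runs_weaken (runs_eq (@runs_transfer z _ _ d.+3 d _) _); try by lia.
    by upd_case.
  by rewrite /s1; upd_solve.
(* The run given by induction is cut before its final [Put], so that one more round can be put in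
   front of its loop. *)
have [st2 [k2 [k3 [ek2 ek3 e]]]] := exec_seq_inv ek.
rewrite -catA in ek1.
rewrite (_ : upd s1 d 0 = upd s d 0) in ek3; last by rewrite /s1; upd_solve.
exists ((k1 + k2).+2 + k3); split; last first.
  by apply: ExecSeq ek3; apply: (@ExecLoopS _ d _ (s, o) _ _ _ _ _ _ ek1 ek2); rewrite prednK.
have lt : (s d)./2.+1 <= s d by lia.
have := leq_mul lt (leqnn (m * 20 + 20)); rewrite mulSn; lia.
Qed.

(** Programs restore the store, temporaries included; hence they can be sequenced and iterated with
    the same bound. *)
Lemma cprog_correct p :
  exists f, poly_bounded f /\
  forall z r s o m, 1 < m -> 0 < size r -> all (leq^~ m) r -> env_ok r (size r).*2 s ->
    runs z (cprog (size r) p) (s, o) (s, o ++ pv z r p) (f m).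
Proof.
elim: p => [|e|e|p [f [pf IHp]] q [g [pg IHq]]|e p [g [pg IHp]]].
- exists (fun=> 0); split=> [|z r s o m _ _ _ _]; first exact: poly_bounded_const.
  by rewrite cats0; apply: runs_skip.
- have [f [pf hf]] := cexp_correct e.
  exists (fun m => f m + (1 + (f m * 2 + 1))); split; first by poly_bounded_tac.
  move=> z r s o m m1 r0 rm h; have [h1 h2 h3 h4] := h.
  have [lv rv] := hf z r _ s o m m1 r0 rm h.
  apply: runs_seq rv _.
  apply: (@runs_seq _ _ _ _ (upd s (size r).*2 (ev z r e), o ++ pv z r (PBit e))).
    by apply: runs_base; rewrite /= updE eqxx cats1.
  apply: runs_weaken (runs_eq (@runs_clear z _ _ _) _); first by rewrite updE eqxx; lia.
  by upd_solve; rewrite h4.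
- have [f [pf hf]] := cexp_correct e.
  exists (fun m => f m + (f m * (f m * 20 + 20) + 2 + 1)); split; first by poly_bounded_tac.
  move=> z r s o m m1 r0 rm h; have [h1 h2 h3 h4] := h.
  have [lv rv] := hf z r _ s o m m1 r0 rm h.
  apply: runs_seq rv _.
  have vd : upd s (size r).*2 (ev z r e) (size r).*2 = ev z r e by rewrite updE eqxx.
  have := @runs_put_nat z (upd s (size r).*2 (ev z r e)) o (size r).*2 (f m).
  rewrite vd => hn.
  apply: runs_seq (hn lv _ _ _) _; try by upd_case; apply: h4; lia.
  apply: runs_weaken (runs_eq (@runs_clear z _ _ _) _); first by rewrite updE eqxx.
  by upd_solve; rewrite h4.
- exists (fun m => f m + g m); split; first by poly_bounded_tac.
  move=> z r s o m m1 r0 rm h; rewrite /= catA.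
  by apply: runs_seq (IHp _ _ _ _ _ m1 r0 rm h) (IHq _ _ _ _ _ m1 r0 rm h).
- have [f [pf hf]] := cexp_correct e; have [a ha] := pf.
  (* Inside the loop the environment also contains an index below [f m], hence at most [m ^ a]. The
     exponent [a.+1] dominates the old variables as well, even if a is 0. *)
  exists (fun m => f m + (f m * (g (m ^ a.+1) + 3) + 1 + (f m * 2 + 1))); split.
    by poly_bounded_tac; apply: poly_bounded_pow.
  move=> z r s o m m1 r0 rm h; have [h1 h2 h3 h4] := h.
  set d := (size r).*2 in h h1 h4 *.
  have [lv rv] := hf z r _ s o m m1 r0 rm h.
  set n := ev z r e in lv rv *.
  pose out j := o ++ flatten [seq pv z (rcons r i) p | i <- iota 0 j].
  apply: runs_seq rv _.
  apply: (@runs_seq _ _ _ _ (upd s d.+1 n, out n)).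
    have := @runs_loop z d (Seq (cprog (size r).+1 p) (Base (Inc d.+1)))
      (fun j => (upd (upd s d (n - j)) d.+1 j, out j)) n (g (m ^ a.+1) + 1).
    rewrite subn0 subnn (_ : out 0 = o) => [hl|]; last by rewrite /out cats0.
    apply: runs_weaken (runs_eq (runs_eq' (hl _ _) _) _).
    + by have := leq_mul lv (leqnn (g (m ^ a.+1) + 3)); lia.
    + by move=> j _; upd_case.
    + move=> j jn /=; rewrite (_ : upd _ _ _ = upd (upd s d (n - j.+1)) d.+1 j); last by upd_solve.
      apply: (@runs_seq _ _ _ _ (upd (upd s d (n - j.+1)) d.+1 j, out j.+1)); last first.
        by apply: runs_base; upd_solve.
      rewrite (_ : out j.+1 = out j ++ pv z (rcons r j) p); last first.
        by rewrite /out -addn1 iotaD map_cat flatten_cat /= cats0 catA.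
      rewrite -(size_rcons r j).
      have mm : m <= m ^ a.+1 by rewrite expnS leq_pmulr // expn_gt0 ltnW.
      apply: IHp; rewrite ?size_rcons //; first exact: leq_trans mm.
      * rewrite all_rcons; apply/andP; split; last first.
          by apply/allP => i /(allP rm) /leq_trans; apply.
        apply: leq_trans (ltnW jn) (leq_trans lv (leq_trans (ha m m1) _)).
        by rewrite leq_exp2l.
      * split; rewrite ?size_rcons ?doubleS //.
        - by upd_case.
        - move=> l; rewrite ltnS leq_eqVlt nth_rcons => /orP[/eqP->|hl'].
            by rewrite ltnn eqxx; upd_case.
          by rewrite hl' -h3 //; upd_case.
        - by move=> i hi; upd_case; apply: h4; lia.
    + by upd_solve; rewrite h4.
    + by upd_solve; rewrite h4.
  apply: runs_weaken (runs_eq (@runs_clear z _ _ _) _); first by rewrite updE eqxx; lia.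
  by upd_solve; rewrite h4.
Qed.

Theorem pv_polytime p : polytime (fun x => pv (doubled x) [:: size x] p).
Proof.
have [f [[a ha] hf]] := cprog_correct p.
(* Counter 0 starts at 2 n + 1. One decrement and a halving put n into counter 1, the place of
   variable 0, and bring the pointer back to 0. *)
pose c := Seq (Base (Dec 0)) (Seq (Loop 0 (Seq (Base (Dec 0)) (Base (Inc 1)))) (cprog 1 p)).
apply: (@cmd_polytime c _ (a + 4)) => x.
pose s := upd (fun=> 0) 1 (size x).
have m1 : 1 < size x + 2 by rewrite addn2.
have rm : all (leq^~ (size x + 2)) [:: size x] by rewrite /= leq_addr.
have h : env_ok [:: size x] (size [:: size x]).*2 s.
  split=> //; first by case.
  by case=> [|[|j]].
have := hf (doubled x) [:: size x] s [::] _ m1 isT rm h; rewrite cat0s => h1.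
suff [k [lek ek]] : runs (doubled x) c (upd (fun=> 0) 0 (size x).*2.+1, [::])
    (s, pv (doubled x) [:: size x] p) (1 + ((size x * 4).+1 + (size x + 2) ^ a)).
  exists s, k; split=> //; apply: leq_trans lek _; rewrite expnD.
  have a0 : 0 < (size x + 2) ^ a by rewrite expn_gt0 addn2.
  by move: a0; set A := _ ^ a; rewrite !expnS expn0; nia.
apply: (@runs_seq _ _ _ _ (upd (fun=> 0) 0 (size x).*2, [::])).
  by apply: runs_base; upd_solve.
apply: runs_seq (runs_weaken (ha _ m1) h1).
suff loop n i : runs (doubled x) (Loop 0 (Seq (Base (Dec 0)) (Base (Inc 1))))
    (upd (upd (fun=> 0) 0 n.*2) 1 i, [::]) (upd (fun=> 0) 1 (i + n), [::]) (n * 4).+1.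
  by apply: runs_eq' (loop (size x) 0) _; upd_solve.
elim: n i => [|n IH] i.
  by exists 1; split=> //; rewrite addn0 (_ : upd (upd _ _ _) _ _ = upd (fun=> 0) 1 i);
    [apply: ExecLoop0 | upd_solve].
have [k [lek ek]] := IH i.+1; exists (2 + k).+2; split; first by lia.
rewrite -addSnnS; apply: (@ExecLoopS _ 0 _ _ _ _ n.*2.+1 _ _ _ _ ek) => //.
apply: (@ExecSeq _ _ _ _ (upd (upd (fun=> 0) 0 n.*2) 1 i, [::]) _ 1 1).
  rewrite (_ : upd (upd _ 0 n.*2) 1 i = (base_den (doubled x) (Dec 0) (upd (upd (upd (fun=> 0) 0 n.+1.*2) 1 i) 0 n.*2.+1, [::])).1); last by upd_solve.
  exact: ExecBase.
rewrite (_ : upd _ 1 i.+1 = (base_den (doubled x) (Inc 1) (upd (upd (fun=> 0) 0 n.*2) 1 i, [::])).1); last by upd_solve.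
exact: ExecBase.
Qed.

Import Order.TTheory GRing.Theory Num.Theory.

(** * Fare zone instances on a path *)

Record toll := Toll { lo : nat; hi : nat; cap : nat; wt : nat }.

Definition path_edges (m : nat) : seq ('I_m.+1 * 'I_m.+1) :=
  [seq (inord i, inord i.+1) | i <- iota 0 m].

Definition toll_commodity (m : nat) (q : toll) : commodity m :=
  Commodity [set e : 'I_m | lo q <= e <= hi q] (cap q) (wt q).

Definition path_fza (m : nat) (qs : seq toll) (t : nat) : fza :=
  @Fza m.+1 (path_edges m) (0%R :: nseq m 1%R)
    [seq toll_commodity _ q | q <- qs] t%:R%R.

Lemma size_path_edges m : size (path_edges m) = m.
Proof. by rewrite size_map size_iota. Qed.

Section PathInstance.

Variables (m : nat) (qs : seq toll) (t : nat).
Hypothesis m_gt0 : 0 < m.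

Notation I := (path_fza m qs t).

Lemma edge_path (e : 'I_(size (edges I))) :
  edge e = (inord e, inord e.+1) :> 'I_m.+1 * 'I_m.+1.
Proof.
have lt : e < m by rewrite -[X in _ < X]size_path_edges.
rewrite /edge (tnth_nth (inord 0, inord 0)) /= (nth_map 0) ?size_iota //.
by rewrite nth_iota.
Qed.

Lemma adj_path (u v : 'I_m.+1) :
  @adj I u v = (v == u.+1 :> nat) || (u == v.+1 :> nat).
Proof.
have h (x y : 'I_m.+1) : ((x, y) \in path_edges m) = (y == x.+1 :> nat).
  apply/mapP/eqP => [[i]|e].
    rewrite mem_iota add0n => /= lt [-> ->].
    by rewrite !inordK // ltnW.
  exists (val x); first by rewrite mem_iota /= -ltnS -e.
  by congr pair; apply: val_inj; rewrite /= inordK // -e.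
by rewrite /adj /= !h.
Qed.

Lemma path_is_tree : is_tree I.
Proof.
split=> //.
- split=> /=.
    rewrite map_inj_in_uniq ?iota_uniq // => i j; rewrite !mem_iota /= => hi hj /(congr1 (fun p => val p.1)).
    rewrite /= !inordK //; exact: ltnW.
  apply/allP => e /mapP[i]; rewrite mem_iota /= => hi ->; rewrite /= !inordK //; exact: ltnW.
- have s : connect_sym (@adj I).
    by apply: sym_connect_sym => u v; rewrite !adj_path orbC.
  have h (v : 'I_m.+1) : connect (@adj I) ord0 v.
    case: v => v lv; elim: v lv => [|v IH] lv.
      by rewrite (_ : Ordinal lv = ord0) ?connect0 //; apply: val_inj.
    apply: connect_trans (IH (ltnW lv)) (connect1 _).
    by rewrite adj_path /= eqxx.
  by move=> u v; apply: connect_trans (h v); rewrite s.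
move=> c c2 uc.
(* Both neighbours on the cycle of its largest vertex would have to be the preceding vertex of the
   path, but a cycle of more than two vertices has distinct neighbours there. *)
have [x xc xmax] : exists2 x, x \in c & forall y, y \in c -> y <= x.
  case: c c2 {uc} => // x0 c _.
  have h0 : x0 \in x0 :: c by rewrite inE eqxx.
  case: (@arg_maxnP _ x0 (mem (x0 :: c)) (fun y : 'I_m.+1 => val y) h0) => x xc h.
  by exists x.
have [i c' ec] := rot_to xc.
have := uc; rewrite -(rot_ucycle i) ec => /andP[].
have : forall y, y \in c' -> y <= x.
  by move=> y yc; apply: xmax; rewrite -(mem_rot i) ec inE yc orbT.
have : 2 < size (x :: c') by rewrite -ec size_rot.
case: c' {ec} => [|y [|w c']] //= _ xm.
rewrite rcons_path => /and3P[a1 _ /andP[_ a2]] /and3P[_ yc _].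
have l1 : y <= x by apply: xm; rewrite inE eqxx.
have lc : last w c' \in w :: c' by apply: mem_last.
have l2 : last w c' <= x by apply: xm; rewrite inE lc orbT.
suff e : y = last w c' by rewrite e lc in yc.
move: a1 a2; rewrite !adj_path => a1 a2; apply: val_inj => /=.
case/orP: a1 => /eqP a1; first by rewrite a1 ltnn in l1.
case/orP: a2 => /eqP a2; last by rewrite a2 ltnn in l2.
by apply: succn_inj; rewrite -a1 -a2.
Qed.

Lemma zip_iota (A : Type) (f : nat -> A) l n :
  zip [seq f i | i <- iota l n.+1] [seq f i | i <- iota l.+1 n] =
  [seq (f i, f i.+1) | i <- iota l n].
Proof. by elim: n l => //= n IH l; congr cons; rewrite -IH. Qed.

Lemma interval_is_path l h : h < m ->
  @is_path I [set e : 'I_(size (edges I)) | l <= e <= h].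
Proof.
move=> hm; case: (leqP l h) => lh; last first.
  (* The empty route is a walk with a single vertex. It does occur, for a block in conflict with
     itself. *)
  exists ord0, [::]; split=> //; apply/setP => e; rewrite !inE.
  by apply/negbTE/negP => /andP[a b]; lia.
exists (inord l), [seq inord i | i <- iota l.+1 (h.+1 - l)].
split.
- have : l + (h.+1 - l) <= m by lia.
  move: (h.+1 - l) => n; elim: n l {lh} => //= n IH l le; rewrite IH ?adj_path; last by lia.
  by rewrite !inordK ?eqxx; lia.
- have -> : inord l :: [seq inord i | i <- iota l.+1 (h.+1 - l)] =
       [seq inord i : 'I_m.+1 | i <- iota l (h.+1 - l).+1] by [].
  rewrite map_inj_in_uniq ?iota_uniq // => i j; rewrite !mem_iota => hi hj e.
  by have := congr1 val e; rewrite /= !inordK //; lia.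
apply/setP => e; rewrite !inE.
have em : e < m by rewrite -[X in _ < X]size_path_edges.
have -> : inord l :: [seq inord i | i <- iota l.+1 (h.+1 - l)] =
       [seq inord i : 'I_m.+1 | i <- iota l (h.+1 - l).+1] by [].
rewrite zip_iota edge_path /=; apply/idP/idP => [he|/orP[]/mapP[i]].
- by apply/orP; left; apply/mapP; exists (nat_of_ord e) => //; case/andP: he => h1 h2; rewrite mem_iota h1 /= subnKC; lia.
- rewrite mem_iota => hi [e1 _].
  have := congr1 val e1; rewrite /= !inordK; first [move=> ->; lia|exact: ltnW|lia].
- rewrite mem_iota => hi [e1 e2].
  have := congr1 val e1; have := congr1 val e2.
  by rewrite /= !inordK; first [move=> ->; lia | exact: em | exact: ltnW | lia].
Qed.

Lemma path_tree_is_path : tree_is_path I.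
Proof.
have h : m.-1 < m by rewrite prednK.
have := interval_is_path 0 h; congr (is_path _); apply/setP => e; rewrite !inE /= -ltnS prednK //.
by have := ltn_ord e; rewrite [X in _ < X]size_path_edges.
Qed.

Lemma fare_path k : fare I k = (0 < k)%:R%R.
Proof.
rewrite /fare /=; case: k => [|k] //=.
(* As m > 0, the table ends with 1, so its continuation is 1 too. *)
have -> : last 0%R (nseq m 1%R) = 1%R :> rat by move: m_gt0; case: (m) => // n _; elim: n.
by rewrite nth_nseq if_same.
Qed.

Hypothesis tolls_ok : all (fun q => (hi q < m) && (0 < wt q)) qs.

Lemma path_valid : fza_valid I.
Proof.
split; first exact: path_is_tree.
- by rewrite /= size_nseq size_path_edges.
- split=> k; rewrite !fare_path ?ler_nat ?ler0n ?leq_b1 //.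
  by rewrite -natrD -mulrnA ler_nat; case: k => [|[]].
move=> j c.
have jq : j < size qs by have := ltn_ord j; rewrite [X in _ < X]size_map.
have -> : c = toll_commodity _ (nth (Toll 0 0 0 0) qs j).
  by rewrite /c (tnth_nth (toll_commodity _ (Toll 0 0 0 0))) /= (nth_map (Toll 0 0 0 0)).
have /andP[h1 h2] := all_nthP (Toll 0 0 0 0) tolls_ok j jq.
by split=> //; apply: interval_is_path.
Qed.

Definition count_in (x : nat -> bool) (l h : nat) : nat := \sum_(l <= i < h.+1) x i.

Definition toll_value (x : nat -> bool) (q : toll) : nat :=
  wt q * (0 < count_in x (lo q) (hi q) <= cap q).

Lemma card_interval (F : {set 'I_(size (edges I))}) (x : nat -> bool) l h :
  (forall e : 'I_(size (edges I)), (e \in F) = x e) -> h < m ->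
  #|[set e : 'I_(size (edges I)) | l <= e <= h] :&: F| = count_in x l h.
Proof.
move=> Fx hm; rewrite -sum1_card big_mkcond /=.
rewrite (eq_bigr (fun e : 'I_(size (edges I)) => if l <= e <= h then nat_of_bool (x e) else 0)).
  rewrite -(big_mkord xpredT (fun e => if l <= e <= h then nat_of_bool (x e) else 0)).
  rewrite size_path_edges -big_mkcond /count_in.
  rewrite (big_nat_widen _ _ _ _ _ hm) [RHS](big_nat_widenl _ 0) //.
  by apply: eq_bigl => i; rewrite andbC.
by move=> e _; rewrite !inE Fx; case: (_ <= _ <= _); case: (x e).
Qed.

Lemma path_yes :
  fza_yes I <-> exists x : nat -> bool, t <= \sum_(q <- qs) toll_value x q.
Proof.
have rev (F : {set 'I_(size (edges I))}) (x : nat -> bool) :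
    (forall e : 'I_(size (edges I)), (e \in F) = x e) ->
    (target I <= \sum_(c <- commodities I) revenue c F)%R =
    (t <= \sum_(q <- qs) toll_value x q).
  move=> Fx; rewrite big_map -(ler_nat rat) natr_sum; congr (_ <= _)%R.
  suff sums s : all (fun q => (hi q < m) && (0 < wt q)) s ->
      (\sum_(q <- s) @revenue I (toll_commodity _ q) F =
       \sum_(q <- s) (toll_value x q)%:R)%R by rewrite sums.
  elim: s => [|q s IH] /=; first by rewrite !big_nil.
  case/andP=> /andP[h _] /IH e; rewrite !big_cons e; congr (_ + _)%R.
  rewrite /revenue fare_path /= (card_interval _ Fx h) /toll_value.
  case: ifP => _; rewrite ?andbT ?andbF ?muln0 //.
  by rewrite natrM.
split=> [[F]|[x hx]].
  pose x i := if insub i is Some e then e \in F else false.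
  rewrite (rev F x) => [h|e]; first by exists x.
  by rewrite /x valK.
exists [set e : 'I_(size (edges I)) | x e]; rewrite (rev _ x) // => e.
by rewrite inE.
Qed.

End PathInstance.

(** * The gadgets: blocks for bits and pairs of tolls for conflicts *)

Lemma leq_sum_const (T : eqType) (s : seq T) (f : T -> nat) c :
  {in s, forall b, f b <= c} -> \sum_(b <- s) f b <= size s * c.
Proof.
elim: s => [|a s IH] h; first by rewrite big_nil.
rewrite big_cons mulSn leq_add ?h ?mem_head // IH // => b bs.
by apply: h; rewrite inE bs orbT.
Qed.

(** This turns a global target into local equalities: it forces the blocks, then the pairs, and
    later one chosen bit per tableau entry. *)
Lemma sum_tight (T : eqType) (s : seq T) (f : T -> nat) c :
  {in s, forall b, f b <= c} -> size s * c <= \sum_(b <- s) f b ->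
  {in s, forall b, f b = c}.
Proof.
elim: s => [|a s IH] h; first by []. rewrite big_cons -[size (a :: s)]/(size s).+1 mulSn => le.
have ha : f a <= c by rewrite h ?mem_head.
have hs : {in s, forall b, f b <= c} by move=> b bs; apply: h; rewrite inE bs orbT.
have := leq_sum_const hs; move: le; move: (\sum_(b <- s) f b) (IH hs) => S {}IH le le2.
move=> b; rewrite inE => /orP[/eqP->|]; first by lia.
by apply: IH; lia.
Qed.

Lemma all_flatten (T : Type) (p : pred T) (ss : seq (seq T)) :
  all p (flatten ss) = all (all p) ss.
Proof. by elim: ss => //= s ss <-; rewrite all_cat. Qed.

Section Gadget.

Variables (N J : nat) (kappa : nat -> nat -> bool).
Hypothesis kappa_leq : forall b b', kappa b b' -> b <= b'.

(* The block [b] consists of the edges [3 b], [3 b + 1] and [3 b + 2], meant to be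
   used according to a bit, to its negation, and always.  A single block toll
   outweighs all the other kinds of tolls together, and a single pair toll all the
   bits. *)
Definition pair_weight : nat := N.+1.
Definition block_weight : nat := 2 * N * N * pair_weight + N.+1.

Definition block_tolls (b : nat) : seq toll :=
  [:: Toll (3 * b) (3 * b + 1) 1 block_weight;
      Toll (3 * b + 2) (3 * b + 2) 1 block_weight;
      Toll (3 * b) (3 * b) 1 1].

(* With [x] the indicator of the block [b] and [x'] that of [b'], the two tolls
   together bring [pair_weight * (1 - kappa b b' * x * x')]. *)
Definition pair_tolls (b b' : nat) : seq toll :=
  let k := kappa b b' in
  [:: Toll (3 * b + 2 - k) (k * (3 * b') + (1 - k) * (3 * b + 2))
        (k * (2 * (b' - b) - 1) + (1 - k)) pair_weight;
      Toll (3 * b + 2 - k) (3 * b + 2 - k) k pair_weight].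

Definition gadget_tolls : seq toll :=
  flatten [seq block_tolls b | b <- iota 0 N] ++
  flatten [seq flatten [seq pair_tolls b b' | b' <- iota 0 N] | b <- iota 0 N].

Definition gadget_target : nat := 2 * N * block_weight + N * N * pair_weight + J.

Lemma gadget_tolls_ok :
  all (fun q => (hi q < 3 * N) && (0 < wt q)) gadget_tolls.
Proof.
rewrite all_cat; apply/andP; split; rewrite all_flatten all_map; apply/allP => b;
  rewrite mem_iota /= => bN.
  by rewrite /block_weight; lia.
rewrite all_flatten all_map; apply/allP => b'; rewrite mem_iota /= => bN'.
by rewrite /pair_weight; case: kappa; rewrite /= ?mul1n ?mul0n; lia.
Qed.

Variable x : nat -> bool.

Lemma count_in1 i : count_in x i i = x i.
Proof. by rewrite /count_in big_nat1. Qed.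

Lemma count_in2 i : count_in x i (i + 1) = x i + x (i + 1).
Proof. by rewrite addn1 /count_in big_nat_recr //= big_nat1. Qed.

Definition block_income b : nat :=
  (0 < x (3 * b) + x (3 * b + 1) <= 1) + x (3 * b + 2).

(** Without conflict both tolls lie on the third edge of [b], with bounds 1 and 0, so the pair
    brings a fixed amount once the blocks are right. All pairs thus have the same maximum, and the
    list of tolls has the same shape for every [kappa]. *)
Definition pair_income b b' : nat :=
  if kappa b b' then (0 < count_in x (3 * b + 1) (3 * b') <= 2 * (b' - b) - 1) + x (3 * b + 1)
  else x (3 * b + 2).

Lemma gadget_value :
  \sum_(q <- gadget_tolls) toll_value x q =
  block_weight * (\sum_(b <- iota 0 N) block_income b) + \sum_(b <- iota 0 N) x (3 * b) +
  pair_weight * (\sum_(b <- iota 0 N) \sum_(b' <- iota 0 N) pair_income b b').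
Proof.
rewrite /gadget_tolls big_cat !big_flatten !big_map /=; congr (_ + _).
  rewrite big_distrr -big_split /=; apply: eq_bigr => b _; rewrite !big_cons big_nil /toll_value /= !count_in1.
  rewrite count_in2 /block_income.
  by case: (x (3 * b)); case: (x (3 * b + 1)); case: (x (3 * b + 2)) => /=; lia.
rewrite big_distrr; apply: eq_bigr => b _; rewrite big_flatten big_map /= big_distrr; apply: eq_bigr => b' _ /=.
rewrite !big_cons big_nil /toll_value /pair_income /=; case: kappa => /=.
  rewrite !mul1n !mul0n !addn0 -addnBA // !count_in1 -[2 - 1]/1 mulnDr.
  by congr (_ + _ * _); case: (x _).
rewrite !mul0n subn0 !add0n mul1n !count_in1; by case: (x _); rewrite /= ?muln0 ?muln1 ?addn0.
Qed.

End Gadget.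

Section GadgetCorrect.

Variables (N J : nat) (kappa : nat -> nat -> bool).
Hypothesis kappa_leq : forall b b', kappa b b' -> b <= b'.

Definition blocks_ok (x : nat -> bool) : Prop :=
  forall b, b < N -> x (3 * b + 1) = ~~ x (3 * b) /\ x (3 * b + 2).

(** Going from a first edge to the next first edge crosses one full block, which has exactly two
    used edges. The interval omits the first edge of [b] and includes that of [b']; the identity is
    stated without subtraction. *)
Lemma count_blocks x b b' : blocks_ok x -> b <= b' -> b' <= N ->
  count_in x (3 * b + 1) (3 * b') + x (3 * b) = 2 * (b' - b) + x (3 * b').
Proof.
move=> ok bb; rewrite -(subnK bb); move: (b' - b) => n {bb b'}.
elim: n => [|n IH] le; first by rewrite add0n subnn /count_in addn1 big_geq.
have := IH (ltnW le); rewrite /count_in => ih; have [h1 h2] := ok (n + b) le.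
rewrite /count_in (_ : (3 * (n.+1 + b)).+1 = (3 * (n + b)).+4); last by lia.
have e k : 3 * (n + b) < k ->
    \sum_(3 * b + 1 <= i < k.+1) x i = \sum_(3 * b + 1 <= i < k) x i + x k.
  by move=> lt; rewrite big_nat_recr //=; lia.
do 3 (rewrite e; last by lia).
rewrite addn1 in h1; rewrite addn2 in h2.
rewrite (_ : 3 * (n.+1 + b) = (3 * (n + b)).+3); last by lia.
rewrite h1 h2 !addnK; move: ih; rewrite addnK; case: (x (3 * (n + b))) => /=; lia.
Qed.

Lemma pair_income_ok x b b' : blocks_ok x -> b < N -> b' < N ->
  pair_income kappa x b b' = ~~ [&& kappa b b', x (3 * b) & x (3 * b')].
Proof.
move=> ok bN bN'; have [h1 h2] := ok b bN; rewrite /pair_income.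
case k: (kappa b b'); last by rewrite h2.
have := count_blocks ok (kappa_leq k) (ltnW bN'); rewrite h1.
(* For a block in conflict with itself the interval is empty and its toll brings nothing. Only the
   toll on the second edge remains, and its 1 - x is 1 - x x. *)
case e: (b == b'); first by rewrite (eqP e); case: (x _) => /=; lia.
have := kappa_leq k; case: (x (3 * b)); case: (x (3 * b')) => /=; lia.
Qed.

Lemma gadget_correct :
  (exists x, gadget_target N J <= \sum_(q <- gadget_tolls N kappa) toll_value x q) <->
  exists X : nat -> bool,
    (forall b b', b < N -> b' < N -> kappa b b' -> ~~ (X b && X b')) /\
    J <= \sum_(b <- iota 0 N) X b.
Proof.
have inN b : (b \in iota 0 N) = (b < N) by rewrite mem_iota add0n.
split=> [[x]|[X [hX hJ]]].
  rewrite gadget_value /gadget_target => le.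
  have leU : \sum_(b <- iota 0 N) x (3 * b) <= N * 1.
    by rewrite -{2}(size_iota 0 N); apply: leq_sum_const => b _; apply: leq_b1.
  have leH : {in iota 0 N, forall b, block_income x b <= 2}.
    by move=> b _; rewrite /block_income; lia.
  (* As long as the blocks are not known to be right, a pair may bring 2: this is the factor 2 in
     [block_weight]. *)
  have leQ : {in iota 0 N, forall b, \sum_(b' <- iota 0 N) pair_income kappa x b b' <= N * 2}.
    move=> b _; rewrite -{2}(size_iota 0 N); apply: leq_sum_const => b' _.
    by rewrite /pair_income; case: ifP => _; lia.
  have := leq_sum_const leQ; have := leq_sum_const leH; rewrite !size_iota => lH lQ.
  (* A missing block toll could not be made up for by all the pairs and bits together. *)
  have eH : {in iota 0 N, forall b, block_income x b = 2}.
    apply: sum_tight leH _; rewrite size_iota leqNgt; apply/negP => lt.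
    have : block_weight N * (\sum_(b <- iota 0 N) block_income x b).+1 <= block_weight N * (N * 2).
      by rewrite leq_mul2l lt orbT.
    have : pair_weight N * \sum_(b <- iota 0 N) \sum_(b' <- iota 0 N) pair_income kappa x b b'
           <= pair_weight N * (N * (N * 2)) by rewrite leq_mul2l lQ orbT.
    move: le leU; rewrite mulnS /block_weight; lia.
  have ok : blocks_ok x.
    move=> b; rewrite -inN => /eH; rewrite /block_income.
    by case: (x (3 * b)); case: (x (3 * b + 1)); case: (x (3 * b + 2)).
  have leP1 : {in iota 0 N, forall b, {in iota 0 N, forall b', pair_income kappa x b b' <= 1}}.
    by move=> b; rewrite inN => bN b'; rewrite inN => bN'; rewrite pair_income_ok ?leq_b1.
  have leQ1 : {in iota 0 N, forall b, \sum_(b' <- iota 0 N) pair_income kappa x b b' <= N}.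
    by move=> b bN; rewrite -[X in _ <= X]muln1 -{2}(size_iota 0 N); apply: leq_sum_const (leP1 b bN).
  have sH : \sum_(b <- iota 0 N) block_income x b = 2 * N.
    rewrite big_seq (eq_bigr (fun=> 2)); last by move=> b; apply: eH.
    by rewrite -big_seq big_const_seq count_predT size_iota iter_addn_0.
  rewrite sH in le.
  (* Now a pair brings at most 1, and a missing unit costs N + 1, more than all the bits bring. *)
  have eQ : {in iota 0 N, forall b, \sum_(b' <- iota 0 N) pair_income kappa x b b' = N}.
    apply: sum_tight leQ1 _; rewrite size_iota leqNgt; apply/negP => lt.
    have : pair_weight N * (\sum_(b <- iota 0 N) \sum_(b' <- iota 0 N) pair_income kappa x b b').+1
           <= pair_weight N * (N * N) by rewrite leq_mul2l lt orbT.
    by move: le leU; rewrite mulnS /pair_weight; lia.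
  exists (fun b => x (3 * b)); split.
    move=> b b' bN bN' k; have /eQ eb : b \in iota 0 N by rewrite inN.
    have := @sum_tight _ (iota 0 N) _ 1 (leP1 b _); rewrite inN size_iota muln1 eb => /(_ bN (leqnn _) b').
    by rewrite inN => /(_ bN'); rewrite pair_income_ok // k /=; case: (_ && _).
  move: le; have := leq_sum_const leQ1; rewrite size_iota => l1.
  have : pair_weight N * \sum_(b <- iota 0 N) \sum_(b' <- iota 0 N) pair_income kappa x b b'
           <= pair_weight N * (N * N) by rewrite leq_mul2l l1 orbT.
  by lia.
pose x i := if i %% 3 == 0 then X (i %/ 3) else if i %% 3 == 1 then ~~ X (i %/ 3) else true.
have x0 b : x (3 * b) = X b by rewrite /x modnMr mulKn.
have x1 b : x (3 * b + 1) = ~~ X b by rewrite /x mulnC modnMDl divnMDl // addn0.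
have x2 b : x (3 * b + 2) = true by rewrite /x mulnC modnMDl.
have ok : blocks_ok x by move=> b _; rewrite x0 x1 x2.
exists x; rewrite gadget_value /gadget_target.
rewrite (eq_bigr (fun=> 2)); last first.
  by move=> b _; rewrite /block_income x0 x1 x2; case: (X b).
have -> : \sum_(b <- iota 0 N) \sum_(b' <- iota 0 N) pair_income kappa x b b' = N * N.
  rewrite big_seq (eq_bigr (fun=> N)) => [|b].
    by rewrite -big_seq big_const_seq count_predT size_iota iter_addn_0.
  rewrite inN => bN; rewrite big_seq (eq_bigr (fun=> 1)) => [|b'].
    by rewrite -big_seq big_const_seq count_predT size_iota iter_addn_0 mul1n.
  rewrite inN => bN'; rewrite pair_income_ok // !x0.
  by case k: kappa => //=; rewrite (hX b b').
rewrite big_const_seq count_predT size_iota iter_addn_0.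
rewrite [X in _ <= _ + X + _](eq_bigr (fun b => nat_of_bool (X b))) => [|b _]; last by rewrite x0.
lia.
Qed.

End GadgetCorrect.

(** * Conflict-free selections as assignments of values to variables *)

Lemma iota_mul (A B : nat) :
  iota 0 (A * B) = flatten [seq [seq i * B + j | j <- iota 0 B] | i <- iota 0 A].
Proof.
elim: A => // A IH; rewrite mulSnr iotaD add0n IH -[in RHS]addn1 iotaD map_cat flatten_cat /= cats0.
by congr (_ ++ _); rewrite -[in LHS](addn0 (A * B)) iotaDl.
Qed.

(** Values of the same variable exclude each other, so a group of D bits has at most one chosen bit,
    and J chosen bits mean exactly one per group. The case j = j' expresses unary constraints, as
    [kappa] may relate a block to itself. *)
Lemma csp_selection J D (kappa : nat -> nat -> bool) :
  (forall j a a', j < J -> a < a' < D -> kappa (j * D + a) (j * D + a')) ->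
  (exists X : nat -> bool,
    (forall b b', b < J * D -> b' < J * D -> kappa b b' -> ~~ (X b && X b')) /\
    J <= \sum_(b <- iota 0 (J * D)) X b) <->
  exists v : nat -> nat,
    (forall j, j < J -> v j < D) /\
    forall j j', j < J -> j' < J -> ~~ kappa (j * D + v j) (j' * D + v j').
Proof.
move=> excl.
have lt j a : j < J -> a < D -> j * D + a < J * D.
  move=> jJ aD; have : j.+1 * D <= J * D by rewrite leq_mul2r jJ orbT.
  by rewrite mulSn; lia.
rewrite iota_mul; split=> [[X [hX]]|[v [v1 v2]]].
  rewrite big_flatten big_map => hJ.
  have inJ j : (j \in iota 0 J) = (j < J) by rewrite mem_iota add0n.
  have inD a : (a \in iota 0 D) = (a < D) by rewrite mem_iota add0n.
  have one j : j < J -> \sum_(b <- [seq j * D + a | a <- iota 0 D]) X b <= 1.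
    move=> jJ; rewrite big_map; case: (boolP (has (fun a => X (j * D + a)) (iota 0 D))).
      case/hasP=> a; rewrite inD => aD Xa.
      rewrite (big_rem a) ?inD //= Xa big1_seq // => a' /=.
      rewrite mem_rem_uniq ?iota_uniq // inE inD => /andP[ne aD'].
      apply/eqP; rewrite eqb0; case: (ltngtP a a') ne => // l _; apply/negP => Xa'.
        have := hX _ _ (lt j a jJ aD) (lt j a' jJ aD').
        by rewrite excl ?l // Xa Xa' => /(_ isT).
      have := hX _ _ (lt j a' jJ aD') (lt j a jJ aD).
      by rewrite excl ?l // Xa Xa' => /(_ isT).
    rewrite -all_predC => /allP h; rewrite big1_seq // => a /andP[_ /h] /=.
    by move/negbTE=> ->.
  pose v j := find (fun a => X (j * D + a)) (iota 0 D).
  have hv j : j < J -> (v j < D) && X (j * D + v j).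
    move=> jJ; have h1 : {in iota 0 J, forall j, \sum_(b <- [seq j * D + a | a <- iota 0 D]) X b <= 1}.
      by move=> i; rewrite inJ; apply: one.
    have := sum_tight h1; rewrite size_iota muln1 => /(_ hJ j); rewrite inJ => /(_ jJ).
    rewrite big_map => e; case: (boolP (has (fun a => X (j * D + a)) (iota 0 D))) => [h|].
      have := h; rewrite has_find size_iota -/(v j) => vD; rewrite vD.
      by have := nth_find 0 h; rewrite -/(v j) nth_iota.
    rewrite -all_predC => /allP h; rewrite big1_seq // in e => a /andP[_ /h] /=.
    by move/negbTE=> ->.
  exists v; split=> [j /hv/andP[]//|j j' /[dup] jJ /hv/andP[h1 h2] /[dup] jJ' /hv/andP[h1' h2']].
  apply/negP => k; have := hX _ _ (lt _ _ jJ h1) (lt _ _ jJ' h1') k.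
  by rewrite h2 h2'.
have D0 j : j < J -> 0 < D by move/v1; apply: leq_trans.
exists (fun b => b %% D == v (b %/ D)); split.
  move=> b b' bN bN' k; apply/negP => /andP[/eqP e /eqP e'].
  have DD : 0 < D by case: (D) bN => //; rewrite muln0.
  have := v2 (b %/ D) (b' %/ D); rewrite !ltn_divLR // => /(_ bN bN').
  by rewrite -e -e' -!divn_eq k.
rewrite big_flatten big_map -[X in X <= _](muln1 J) -{1}(size_iota 0 J) mulnC.
rewrite -iter_addn_0 -(count_predT (iota 0 J)) -big_const_seq.
rewrite big_seq [X in _ <= X]big_seq; apply: leq_sum => j.
rewrite mem_iota add0n => /= jJ; rewrite big_map (big_rem (v j)) ?mem_iota ?v1 //=.
by rewrite modnMDl divnMDl ?(D0 j) // modn_small ?divn_small ?addn0 ?eqxx ?v1.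
Qed.

(** * Computation tableaux *)

Section Tableau.

Variable M : machine.

Notation sym := (option (bool + aux M)).
Notation row := {ffun 'I_(work_tapes M).+1 -> sym}.

(* A tableau entry consists of the state, of the scanned symbols, and of the
   symbols at one given offset from the heads. *)
Definition entry : finType := (state M * row * row)%type.

Definition estate (v : entry) : state M := v.1.1.
Definition escan (v : entry) : row := v.1.2.
Definition esyms (v : entry) : row := v.2.

Definition emove (v : entry) : state M * ('I_(work_tapes M).+1 -> sym * direction) :=
  if halting (estate v) then (estate v, fun i => (escan v i, Stay))
  else trans (estate v) (fun i => escan v i).

(** Offsets from -B to B are represented by adding B, so that [o = B] is the scanned cell. *)
Definition cell_at (B : nat) (t : tape M) (o : nat) : sym :=
  if o < B then nth None t.1 (B - o.+1) else nth None t.2 (o - B).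

Definition entry_of (B : nat) (c : config M) (o : nat) : entry :=
  (c.1, [ffun i => scanned (c.2 i)], [ffun i => cell_at B (c.2 i) o]).

Lemma cell_at_center B t : cell_at B t B = scanned t.
Proof. by rewrite /cell_at ltnn subnn /scanned nth0. Qed.

(* [moved k o o']: the cell at offset [o] comes to offset [o'] when the head
   makes the move numbered [k]. *)
Definition move_kind (d : direction) : nat :=
  match d with Stay => 0 | GoLeft => 1 | GoRight => 2 end.

Definition moved (k o o' : nat) : bool :=
  match k with 0 => o' == o | 1 => o' == o.+1 | _ => o == o'.+1 end.

Lemma cell_at_move B d a t o o' : moved (move_kind d) o o' ->
  cell_at B (move_head d (write a t)) o' = if o == B then a else cell_at B t o.
Proof.
case: t => l r; rewrite /cell_at /write; case: d => /= /eqP ->.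
- case: (ltngtP o B) => oB.
  + case: (ltngtP o.+1 B) => h; first by rewrite nth_behead; congr nth; lia.
      by lia.
    by rewrite h subnn /= nth0.
  + rewrite ltnNge ltnW ?ltnS ?(ltnW oB) //= subSn ?(ltnW oB) //=.
    by rewrite (_ : o - B = (o - B.+1).+1) /= ?nth_behead //; lia.
  + by rewrite oB ltnNge leqnSn /= subSnn.
- case: (ltngtP o B) => oB //.
    by rewrite (_ : o - B = (o - B.+1).+1) /= ?nth_behead //; lia.
  by rewrite oB subnn.
- case: (ltngtP o' B) => oB.
  + case: (ltngtP o'.+1 B) => h; first by rewrite (_ : B - o'.+1 = (B - o'.+2).+1) //; lia.
      by lia.
    by rewrite -h subnn.
  + rewrite ltnNge ltnW ?ltnS ?(ltnW oB) //= nth_behead subSn ?(ltnW oB) //.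
    by rewrite gtn_eqF // leqW.
  + by rewrite oB ltnNge leqnSn /= gtn_eqF // subnn nth_behead subSnn.
Qed.

(** Each entry carries the state and all the scanned symbols, so the move can be computed locally.
    The tapes move independently: [k] selects those whose cell passes from the first entry to the
    second, and the three values of [k] correspond to three diagonals. *)
Definition vertical_ok (k : nat) (at_head : bool) (v v' : entry) : bool :=
  (estate v' == (emove v).1) &&
  [forall i, (move_kind ((emove v).2 i).2 == k) ==>
     (esyms v' i == if at_head then ((emove v).2 i).1 else esyms v i)].

Definition horizontal_ok (v v' : entry) : bool :=
  (estate v == estate v') && (escan v == escan v').

(** In the initial row this makes the guessed certificate a bit string followed by blanks only. *)
Definition blank_spreads (v v' : entry) : bool :=
  (esyms v ord0 == None) ==> (esyms v' ord0 == None).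

Definition center_ok (v : entry) : bool := escan v == esyms v.

Definition start_ok (v : entry) : bool :=
  (estate v == start M) && [forall i, (i != ord0) ==> (esyms v i == None)].

Definition sym_is (a : sym) (v : entry) : bool := esyms v ord0 == a.

Definition not_aux (v : entry) : bool :=
  if esyms v ord0 is Some (inr _) then false else true.

Lemma emove_entry_of B c o :
  (step c).1 = (emove (entry_of B c o)).1 /\
  forall i o1 o2, moved (move_kind ((emove (entry_of B c o)).2 i).2) o1 o2 ->
    cell_at B ((step c).2 i) o2 =
    if o1 == B then ((emove (entry_of B c o)).2 i).1 else cell_at B (c.2 i) o1.
Proof.
rewrite /emove /step /entry_of /estate /escan /=.
have -> : (fun i => [ffun i0 => scanned (c.2 i0)] i) = (fun i => scanned (c.2 i)).
  by apply: functional_extensionality => i; rewrite ffunE.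
case: ifP => h.
  by split=> // i o1 o2 /= /eqP ->; rewrite ffunE; case: eqP => // ->; rewrite cell_at_center.
by case: trans => q act; split=> //= i o1 o2; apply: cell_at_move.
Qed.

Variables (x : seq bool) (B T P : nat).

Let n := size x.

(** At index 2 n the default of [nth false] is the separator that [enc_pair] puts after [x]. The P
    cells behind it may hold bits or blanks: there the certificate is guessed. *)
Definition entry_conflict (t o : nat) (v : entry) : bool :=
  [|| (o == B) && ~~ center_ok v,
      (t == 0) && ~~ start_ok v,
      [&& t == 0, o < B & ~~ sym_is None v],
      [&& t == 0, B <= o, o <= B + 2 * n &
          ~~ sym_is (Some (inl (nth false (doubled x) (o - B)))) v],
      [&& t == 0, B + 2 * n < o & ~~ not_aux v],
      [&& t == 0, B + 2 * n + P < o & ~~ sym_is None v] |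
      [&& t == T, o == B & ~~ sym_is (Some (inl true)) v]].

Definition pair_conflict (t o : nat) (v : entry) (t' o' : nat) (v' : entry) : bool :=
  [|| [&& t' == t, o' == o.+1 & ~~ horizontal_ok v v'],
      [&& t == 0, t' == 0, o' == o.+1, B <= o & ~~ blank_spreads v v'],
      [&& t' == t.+1, o' == o & ~~ vertical_ok 0 (o == B) v v'],
      [&& t' == t.+1, o' == o.+1 & ~~ vertical_ok 1 (o == B) v v'] |
      [&& t' == t.+1, o == o'.+1 & ~~ vertical_ok 2 (o == B) v v']].

Definition width : nat := (2 * B).+1.

Definition consistent (val : nat -> nat -> entry) : Prop :=
  (forall t o, t <= T -> o < width -> ~~ entry_conflict t o (val t o)) /\
  (forall t o t' o', t <= T -> o < width -> t' <= T -> o' < width ->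
     ~~ pair_conflict t o (val t o) t' o' (val t' o')).

(** The part [2 * n + 1 + P] makes the whole input fit into the initial row, and T keeps the
    disturbed ends of the rows away from the heads. *)
Hypothesis B_large : T + 2 * n + 1 + P <= B.

Definition run (y : seq bool) (t : nat) : config M :=
  iter t (@step M) (init M (enc_pair x y)).

Lemma enc_pairE y : enc_pair x y = rcons (doubled x) false ++ y.
Proof.
rewrite /enc_pair /enc_bits /enc_seq -cats1 /doubled; congr ((_ ++ _) ++ _).
Qed.

Lemma init_cell y i o : cell_at B ((init M (enc_pair x y)).2 i) o =
  if i == ord0 then
    if o < B then None
    else nth None [seq Some (inl b) | b <- enc_pair x y] (o - B)
  else None.
Proof.
rewrite /cell_at /=; case: (i == ord0) => /=; first by rewrite nth_nil.
by rewrite !nth_nil if_same.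
Qed.

Lemma input_sym y o : esyms (entry_of B (run y 0) o) ord0 =
  if o < B then None
  else if o <= B + 2 * n then Some (inl (nth false (doubled x) (o - B)))
  else nth None [seq Some (inl b) | b <- y] (o - (B + 2 * n).+1).
Proof.
rewrite /esyms ffunE init_cell eqxx enc_pairE map_cat nth_cat size_map size_rcons.
rewrite size_doubled -mul2n -/n; case: (leqP B o) => // Bo.
case: (leqP o (B + 2 * n)) => oB.
  have lt : o - B < (2 * n).+1 by lia.
  rewrite lt (nth_map false) ?size_rcons ?size_doubled -?mul2n //.
  rewrite nth_rcons size_doubled -mul2n -/n; case: ltnP => // h.
  by rewrite nth_default ?if_same // size_doubled -mul2n.
by rewrite ltnNge (_ : (2 * n).+1 <= o - B) /=; [congr nth; lia | lia].
Qed.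

Lemma consistent_run y : size y <= P ->
  scanned ((run y T).2 ord0) = Some (inl true) ->
  consistent (fun t o => entry_of B (run y t) o).
Proof.
move=> yP acc; split=> [t o tT oW|t o t' o' tT oW tT' oW'].
  apply/negP; rewrite /entry_conflict => /or4P[|||/or4P[]].
  - case/andP=> /eqP -> /negP; apply; apply/eqP/ffunP => i.
    by rewrite !ffunE cell_at_center.
  - case/andP=> /eqP -> /negP; apply; rewrite /start_ok /estate eqxx /=.
    by apply/forallP => i; apply/implyP => i0; rewrite ffunE init_cell (negbTE i0).
  - by case/and3P=> /eqP -> oB /negP; apply; rewrite /sym_is input_sym oB.
  - by case/and4P=> /eqP -> Bo oB /negP; apply; rewrite /sym_is input_sym oB ltnNge Bo.
  - case/and3P=> /eqP -> oB /negP; apply; rewrite /not_aux input_sym ltnNge (leq_trans (leq_addr _ _) (ltnW oB)) /=.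
    rewrite leqNgt oB /=; case: (ltnP (o - (B + 2 * n).+1) (size y)) => h; first by rewrite (nth_map false).
    by rewrite nth_default ?size_map.
  - case/and3P=> /eqP -> oB /negP; apply; rewrite /sym_is input_sym.
    have Bo : B + 2 * n < o by apply: leq_ltn_trans (leq_addr _ _) oB.
    rewrite ltnNge (leq_trans (leq_addr _ _) (ltnW Bo)) (leqNgt o) Bo /=.
    by rewrite nth_default ?size_map //; lia.
  - case/and3P=> /eqP -> /eqP -> /negP; apply.
    by rewrite /sym_is /esyms ffunE cell_at_center acc.
have vert k : moved k o o' -> vertical_ok k (o == B) (entry_of B (run y t) o) (entry_of B (run y t.+1) o').
  move=> mv; have [s1 s2] := emove_entry_of B (run y t) o.
  apply/andP; split; first by rewrite -s1.
  apply/forallP => i; apply/implyP => /eqP ek; rewrite ffunE (s2 i o o') ?ek //.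
  by case: (_ == B) => //; rewrite /esyms ffunE.
apply/negP; rewrite /pair_conflict => /or4P[|||/orP[]].
- case/and3P=> /eqP -> _ /negP; apply; rewrite /horizontal_ok eqxx /=.
  by apply/eqP/ffunP => i; rewrite !ffunE.
- case/and5P=> /eqP -> /eqP -> /eqP -> Bo /negP; apply.
  rewrite /blank_spreads !input_sym !ltnNge Bo (leqW Bo) /=.
  case: (leqP o (B + 2 * n)) => //= oB; rewrite (ltnW oB) /=.
  apply/implyP => /eqP h; rewrite nth_default ?size_map // subSS leqNgt; apply/negP => lt.
  have : o - (B + 2 * n).+1 < size y by lia.
  by move=> lt'; rewrite (nth_map false) in h.
- by case/and3P=> /eqP -> oo /negP; apply; apply: vert.
- by case/and3P=> /eqP -> oo /negP; apply; apply: vert.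
- by case/and3P=> /eqP -> oo /negP; apply; apply: vert.
Qed.

Lemma blank_spread_bits k (f : nat -> sym) :
  (forall j, j < k -> if f j is Some (inr _) then False else True) ->
  (forall j, j.+1 < k -> f j = None -> f j.+1 = None) ->
  exists2 y : seq bool, size y <= k &
    forall j, j < k -> f j = nth None [seq Some (inl b) | b <- y] j.
Proof.
elim: k f => [|k IH] f h1 h2; first by exists [::].
have [|j jk|y yk hy] := IH (f \o S); first by move=> j jk; apply: h1.
  by apply: h2.
case f0: (f 0) => [[b|a]|]; last 1 first.
- exists [::] => // j; rewrite nth_nil; elim: j => // j IHj jk.
  by apply: h2 => //; apply: IHj; apply: ltnW.
- by exists (b :: y) => // -[|j] jk //=; apply: hy.
- by have := h1 0 isT; rewrite f0.
Qed.

(** The scanned symbols are tied to actual symbols at the centre only; the horizontal conditions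
    carry them from there to both ends of the row. *)
Lemma escan_row val t : consistent val -> t <= T ->
  forall o, o < width -> escan (val t o) = esyms (val t B).
Proof.
move=> [c1 c2] tT o oW.
have BW : B < width by rewrite /width; lia.
have center : center_ok (val t B).
  by have := c1 t B tT BW; rewrite /entry_conflict eqxx negb_or => /andP[/negPn].
have hor e1 e2 : e1 <= e2 -> e2 < width -> escan (val t e1) = escan (val t e2).
  move=> le; rewrite -(subnK le); elim: (e2 - e1) => //= k IHk kW.
  rewrite IHk; last by lia.
  have := c2 t (k + e1) t (k.+1 + e1) tT (ltnW kW) tT kW.
  by rewrite /pair_conflict eqxx addSn eqxx /= negb_or => /andP[/negPn/andP[_ /eqP->]].
rewrite -(eqP center); case: (leqP o B) => oB; first exact: hor.
by apply/esym; apply: hor => //; apply: ltnW.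
Qed.

Lemma consistent_input val : consistent val ->
  exists2 y, size y <= P & forall o, o < width -> val 0 o = entry_of B (run y 0) o.
Proof.
move=> cv; have scan := escan_row cv (leq0n T); have [c1 c2] := cv.
have un o : o < width -> ~~ entry_conflict 0 o (val 0 o) by apply: c1.
pose f j := esyms (val 0 ((B + 2 * n).+1 + j)) ord0.
have [j jP|j jP|y yP hy] := @blank_spread_bits P f.
- have := un ((B + 2 * n).+1 + j); rewrite /entry_conflict /width => /(_ ltac:(lia)).
  rewrite !negb_or => /and5P[_ _ _ _ /and3P[h _ _]]; move: h.
  rewrite eqxx leq_addr /= negbK /not_aux /f.
  by case: (esyms _ _) => [[]|].
- have := c2 0 ((B + 2 * n).+1 + j) 0 ((B + 2 * n).+1 + j).+1.
  rewrite /width => /(_ isT ltac:(lia) isT ltac:(lia)).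
  rewrite /pair_conflict !eqxx !negb_or => /and3P[_ h _] fj; move: h.
  rewrite (_ : B <= _) /=; last by lia.
  by rewrite negbK /blank_spreads -/(f j) fj eqxx -addnS => /eqP.
exists y => // o oW.
have /andP[/eqP st blk] : start_ok (val 0 o).
  by have := un o oW; rewrite /entry_conflict eqxx /= !negb_or => /and3P[_ /negPn].
have sym0 e : e < width -> esyms (val 0 e) ord0 = esyms (entry_of B (run y 0) e) ord0.
  move=> eW; rewrite input_sym.
  have := un e eW; rewrite /entry_conflict !negb_or !eqxx.
  case/and5P=> _ _ h1 h2 /and3P[_ h3 _].
  case: ltnP => eB; first by move: h1; rewrite eB /= negbK => /eqP.
  case: leqP => eB2; first by move: h2; rewrite eB eB2 /= negbK => /eqP.
  case: (leqP e (B + 2 * n + P)) => eP.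
    by rewrite -hy ?/f; [congr (esyms (val 0 _) _); lia | lia].
  move: h3; rewrite eP /= negbK => /eqP ->.
  by rewrite nth_default // size_map; lia.
have symi e i : e < width -> esyms (val 0 e) i = cell_at B ((run y 0).2 i) e.
  move=> eW; case: (eqVneq i ord0) => [->|i0].
    by rewrite sym0 // /esyms ffunE.
  have : start_ok (val 0 e).
    by have := un e eW; rewrite /entry_conflict eqxx /= !negb_or => /and3P[_ /negPn].
  by case/andP=> _ /forallP/(_ i); rewrite i0 => /eqP ->; rewrite init_cell (negbTE i0).
rewrite [val _ _]surjective_pairing [(val _ _).1]surjective_pairing.
rewrite -/(estate _) -/(escan _) -/(esyms _) st scan //.
congr (_, _, _); apply/ffunP => i; rewrite !ffunE symi // ?cell_at_center //.
by rewrite /width; lia.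
Qed.

Lemma consistent_accepts val : consistent val ->
  exists2 y, size y <= P & scanned ((run y T).2 ord0) = Some (inl true).
Proof.
move=> cv; have [y yP h0] := consistent_input cv; exists y => //.
have [c1 c2] := cv.
(* Nothing constrains what enters at the ends of a row, but it moves inwards by at
   most one cell per step, hence does not reach the heads within [T <= B] steps. *)
suff key t : t <= T -> forall o, t <= o -> o + t < width -> val t o = entry_of B (run y t) o.
  have := c1 T B (leqnn _); rewrite key //; last by rewrite /width; lia.
    have BW : B < width by rewrite /width; lia.
    move=> /(_ BW); rewrite /entry_conflict !eqxx /sym_is /esyms /= ffunE cell_at_center.
    by rewrite !negb_or => /and5P[_ _ _ _ /and3P[_ _ /negPn/eqP]].
  by lia.
elim: t => [_ o _|t IH tT o oT oW]; first by rewrite addn0; apply: h0.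
have tT' := ltnW tT.
have H e : t <= e -> e + t < width -> val t e = entry_of B (run y t) e by apply: IH.
have st e : t < e -> e + t.+1 < width ->
    estate (val t.+1 e) = (run y t.+1).1 /\
    esyms (val t.+1 e) = [ffun i => cell_at B ((run y t.+1).2 i) e].
  move=> te eW; have [s1 s2] := emove_entry_of B (run y t) e.
  have vert k e' : moved k e' e -> t <= e' -> e' + t < width -> k <= 2 ->
      vertical_ok k (e' == B) (entry_of B (run y t) e') (val t.+1 e).
    move=> mv te' eW' k2; have := c2 t e' t.+1 e tT'; rewrite H // => /(_ _ tT _)/negP h.
    apply/negPn/negP => nv; apply: h; rewrite ?/width; try by move: eW eW'; rewrite /width; lia.
    rewrite /pair_conflict eqxx; case: k k2 mv nv => [|[|[|]]] // _ /= /eqP -> ->.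
    - by rewrite eqxx !orbT.
    - by rewrite eqxx !orbT.
    - by rewrite eqxx !orbT.
  split.
    have := vert 0 e; rewrite /= eqxx => /(_ isT); case/(_ _ _ isT)/andP; try lia.
    by move=> /eqP -> _; rewrite -s1.
  apply/ffunP => i; rewrite ffunE.
  (* Tape i obtains its symbol along the diagonal of its own move. *)
  pose d := ((emove (entry_of B (run y t) e)).2 i).2.
  have [e' [mv te' eW' k2]] : exists e', [/\ moved (move_kind d) e' e, t <= e', e' + t < width & move_kind d <= 2].
    by case: d; [exists e.-1 | exists e | exists e.+1]; rewrite /= ?eqxx //; split; lia.
  have /andP[_ /forallP/(_ i)] := vert _ _ mv te' eW' k2.
  rewrite (s2 i e' e mv) => /implyP/(_ (eqxx _))/eqP ->.
  by case: (_ == B) => //; rewrite /esyms ffunE.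
(* The scanned symbols of the new row are those at its centre, which has just been determined. *)
have [||sB1 sB2] := st B; try by rewrite /width; lia.
have [so1 so2] := st o oT oW.
rewrite [val _ _]surjective_pairing [(val _ _).1]surjective_pairing.
rewrite -/(estate _) -/(escan _) -/(esyms _) so1 so2 (escan_row cv tT) ?sB2; last by move: oW; rewrite /width; lia.
by congr (_, _, _); apply/ffunP => i; rewrite !ffunE cell_at_center.
Qed.

End Tableau.

(** * The reduction *)

Section Conflicts.

Variables (M : machine) (x : seq bool) (B T P : nat).
Hypothesis B_large : T + 2 * size x + 1 + P <= B.

Definition alphabet_size : nat := #|entry M|.

Definition decode_entry (a : nat) : entry M :=
  nth (start M, [ffun=> None], [ffun=> None]) (enum (entry M)) a.

(** The first clause excludes two values at one entry and is oriented by [<], so that the smaller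
    block comes first. The second relates a block to itself and thereby expresses a unary
    condition. *)
Definition conflict (t o a t' o' a' : nat) : bool :=
  [|| [&& t == t', o == o' & a < a'],
      [&& t == t', o == o', a == a' & entry_conflict x B T P t o (decode_entry a)] |
      pair_conflict B t o (decode_entry a) t' o' (decode_entry a')].

Definition block (t o a : nat) : nat := (t * width B + o) * alphabet_size + a.

Definition block_conflict (b b' : nat) : bool :=
  let D := alphabet_size in let W := width B in
  conflict (b %/ D %/ W) (b %/ D %% W) (b %% D) (b' %/ D %/ W) (b' %/ D %% W) (b' %% D).

Lemma alphabet_gt0 : 0 < alphabet_size.
Proof. by apply/card_gt0P; exists (start M, [ffun=> None], [ffun=> None]). Qed.

Lemma block_conflictE t o a t' o' a' :
  o < width B -> a < alphabet_size -> o' < width B -> a' < alphabet_size ->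
  block_conflict (block t o a) (block t' o' a') = conflict t o a t' o' a'.
Proof.
move=> oW aD oW' aD'; rewrite /block_conflict /block.
have W0 : 0 < width B by [].
have quo d q r : r < d -> (q * d + r) %/ d = q.
  by move=> lt; rewrite divnMDl ?(leq_ltn_trans _ lt) // divn_small ?addn0.
have rem d q r : r < d -> (q * d + r) %% d = r.
  by move=> lt; rewrite modnMDl modn_small.
by rewrite !(quo _ _ _ aD) !(quo _ _ _ aD') !(rem _ _ _ aD) !(rem _ _ _ aD') !quo // !rem.
Qed.

Lemma block_surj b :
  exists t o a, [/\ o < width B, a < alphabet_size & b = block t o a].
Proof.
have D0 := alphabet_gt0.
exists (b %/ alphabet_size %/ width B), (b %/ alphabet_size %% width B), (b %% alphabet_size).
by rewrite !ltn_mod; split=> //; rewrite /block -!divn_eq.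
Qed.

(** The pair tolls need conflicts directed towards later blocks. For 0 < B a row is long enough that
    passing to the next row and one offset back still increases the number. *)
Lemma block_conflict_leq b b' : 0 < B -> block_conflict b b' -> b <= b'.
Proof.
clear B_large; move=> B0; have W2 : 2 < width B by rewrite /width; lia.
have [t [o [a [oW aD ->]]]] := block_surj b; have [t' [o' [a' [oW' aD' ->]]]] := block_surj b'.
rewrite block_conflictE // /block.
set j := t * width B + o; set j' := t' * width B + o'.
have far : j < j' -> j * alphabet_size + a <= j' * alphabet_size + a'.
  move=> lt; have : j.+1 * alphabet_size <= j' * alphabet_size by rewrite leq_mul2r lt orbT.
  by rewrite mulSn; lia.
rewrite /conflict /pair_conflict => /or3P[/and3P[/eqP e1 /eqP e2 l]|/and4P[/eqP e1 /eqP e2 /eqP e3 _]|].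
- by rewrite /j /j' e1 e2 leq_add2l ltnW.
- by rewrite /j /j' e1 e2 e3.
case/or4P=> [/and3P[/eqP e1 /eqP e2 _]|/and5P[/eqP e1 /eqP e3 /eqP e2 _ _]|
  /and3P[/eqP e1 /eqP e2 _]|/orP[/and3P[/eqP e1 /eqP e2 _]|/and3P[/eqP e1 /eqP e2 _]]];
  apply: far; rewrite /j /j' ?e1 ?e2 ?e3 ?mulSn; lia.
Qed.

Lemma conflict_free :
  (exists X : nat -> bool,
    (forall b b', b < T.+1 * width B * alphabet_size -> b' < T.+1 * width B * alphabet_size ->
       block_conflict b b' -> ~~ (X b && X b')) /\
    T.+1 * width B <= \sum_(b <- iota 0 (T.+1 * width B * alphabet_size)) X b) <->
  exists2 y, size y <= P & scanned ((run M x y T).2 ord0) = Some (inl true).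
Proof.
have W0 : 0 < width B by [].
have jW t o : t <= T -> o < width B -> t * width B + o < T.+1 * width B.
  move=> tT oW; have : t.+1 * width B <= T.+1 * width B by rewrite leq_mul2r ltnS tT orbT.
  by rewrite mulSn; lia.
have tj j : j < T.+1 * width B -> j %/ width B <= T by move=> h; rewrite -ltnS ltn_divLR.
rewrite csp_selection; last first.
  move=> j a a' _ /andP[aa' aD']; rewrite (divn_eq j (width B)).
  by rewrite block_conflictE ?ltn_mod ?(ltn_trans aa') // /conflict !eqxx aa'.
split=> [[v [v1 v2]]|[y yP acc]].
  apply: (consistent_accepts B_large (val := fun t o => decode_entry (v (t * width B + o)))).
  have v3 t o t' o' : t <= T -> o < width B -> t' <= T -> o' < width B ->
      ~~ conflict t o (v (t * width B + o)) t' o' (v (t' * width B + o')).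
    move=> tT oW tT' oW'; rewrite -block_conflictE ?v1 ?jW //.
    by apply: v2; apply: jW.
  split=> [t o tT oW|t o t' o' tT oW tT' oW'].
    apply/negP => h; have /negP := v3 t o t o tT oW tT oW; apply.
    by rewrite /conflict !eqxx h /= orbT.
  apply/negP => h; have /negP := v3 t o t' o' tT oW tT' oW'; apply.
  by rewrite /conflict h !orbT.
have [c1 c2] := consistent_run B_large yP acc.
pose v j := index (entry_of B (run M x y (j %/ width B)) (j %% width B)) (enum (entry M)).
have dv t o : o < width B -> decode_entry (v (t * width B + o)) = entry_of B (run M x y t) o.
  move=> oW; rewrite /decode_entry /v nth_index ?mem_enum //.
  by rewrite divnMDl // divn_small // addn0 modnMDl modn_small.
have v1 j : v j < alphabet_size by rewrite /v /alphabet_size cardE index_mem mem_enum.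
exists v; split=> // j j' jJ jJ'; rewrite (divn_eq j (width B)) (divn_eq j' (width B)).
set t := j %/ _; set o := j %% _; set t' := j' %/ _; set o' := j' %% _.
have oW : o < width B by rewrite ltn_mod.
have oW' : o' < width B by rewrite ltn_mod.
rewrite block_conflictE // /conflict !dv //; apply/negP.
case/or3P=> [/and3P[/eqP-> /eqP->]|/and4P[_ _ _]|].
- by rewrite ltnn.
- by apply/negP; apply: c1; rewrite ?tj.
- by apply/negP; apply: c2; rewrite ?tj.
Qed.

End Conflicts.

(** * The encoding of the path instance and the size of its numbers *)

Definition enc_rat_nat (k : nat) : seq bool := false :: enc_nat k ++ enc_nat 1.

Lemma enc_rat_natE k : enc_rat k%:R%R = enc_rat_nat k.
Proof.
by rewrite /enc_rat ltrn0 -[k%:R%R]/((k%:Z)%:~R)%R numq_int denq_int.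
Qed.

Definition enc_toll (m : nat) (q : toll) : seq bool :=
  [seq lo q <= e <= hi q | e <- iota 0 m] ++ enc_nat (cap q) ++ enc_nat (wt q).

Definition enc_tolls (m : nat) (qs : seq toll) : seq bool :=
  flatten [seq true :: enc_toll m q | q <- qs].

Lemma enc_tolls_cat m qs qs' : enc_tolls m (qs ++ qs') = enc_tolls m qs ++ enc_tolls m qs'.
Proof. by rewrite /enc_tolls map_cat flatten_cat. Qed.

Lemma enc_tolls_flatten m (A : Type) (f : A -> seq toll) s :
  enc_tolls m (flatten [seq f a | a <- s]) = flatten [seq enc_tolls m (f a) | a <- s].
Proof. by elim: s => //= a s IH; rewrite enc_tolls_cat IH. Qed.

Lemma enc_toll_commodity m q :
  enc_commodity (toll_commodity m q) = enc_toll m q.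
Proof.
rewrite /enc_commodity /enc_toll /=; congr (_ ++ _).
by rewrite -val_enum_ord -map_comp; apply: eq_map => e; rewrite inE.
Qed.

Lemma encode_path m qs t : fza_encode (path_fza m qs t) =
  enc_nat m.+1 ++
  (flatten [seq true :: enc_nat i ++ enc_nat i.+1 | i <- iota 0 m] ++ [:: false]) ++
  ((true :: enc_rat_nat 0 ++ flatten [seq true :: enc_rat_nat 1 | i <- iota 0 m])
     ++ [:: false]) ++
  (enc_tolls m qs ++ [:: false]) ++ enc_rat_nat t.
Proof.
rewrite /fza_encode; congr (_ ++ _); congr (_ ++ _).
  rewrite /enc_seq /= /path_edges -map_comp; congr (flatten _ ++ _).
  apply/eq_in_map => i; rewrite mem_iota /= => im.
  by rewrite !inordK // ltnW.
congr (_ ++ _).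
  have e0 : enc_rat 0%R = enc_rat_nat 0 by exact: (enc_rat_natE 0).
  rewrite /enc_seq; congr (_ ++ _).
  transitivity ((true :: enc_rat 0%R) ++ flatten [seq true :: enc_rat a | a <- nseq m 1%R]).
    by [].
  rewrite e0 -cat_cons; congr (_ ++ _).
  have e1 : enc_rat 1%R = enc_rat_nat 1 by exact: (enc_rat_natE 1).
  rewrite map_nseq e1; move: (true :: enc_rat_nat 1) => w.
  by elim: m 0 {qs t} => //= k IH j; rewrite (IH j.+1).
congr (_ ++ _); last by rewrite /= enc_rat_natE.
rewrite /enc_seq /enc_tolls /= -map_comp; congr (flatten _ ++ _).
by apply: eq_map => q /=; rewrite enc_toll_commodity size_path_edges.
Qed.

Lemma size_enc_seq (A : Type) (enc : A -> seq bool) s : size s <= size (enc_seq enc s).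
Proof.
by rewrite /enc_seq; elim: s => //= a s IH; rewrite -catA size_cat; move: IH; lia.
Qed.

(** The list of edges alone accounts for m. A lower bound is needed because strong hardness measures
    the numbers against the length of the encoding. *)
Lemma size_encode_path m qs t : m <= size (fza_encode (path_fza m qs t)).
Proof.
rewrite encode_path size_cat [X in _ + X]size_cat.
have := size_enc_seq (fun i => enc_nat i ++ enc_nat i.+1) (iota 0 m).
by rewrite size_iota /enc_seq; move: (size _) => k; lia.
Qed.

Lemma rat_height_nat k : rat_height k%:R%R <= maxn k 1.
Proof. by rewrite /rat_height -[k%:R%R]/((k%:Z)%:~R)%R numq_int denq_int. Qed.

Lemma maxnum_path m qs t K : 0 < K -> t <= K ->
  all (fun q => (cap q <= K) && (wt q <= K)) qs ->
  fza_maxnum (path_fza m qs t) <= K.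
Proof.
move=> K0 tK hq.
have h0 : rat_height 0%R <= K by exact: (leq_trans (rat_height_nat 0) K0).
have h1 : rat_height 1%R <= K by exact: (leq_trans (rat_height_nat 1) K0).
rewrite /fza_maxnum geq_max; apply/andP; split; last (rewrite geq_max; apply/andP; split).
- by apply: leq_trans (rat_height_nat t) _; rewrite geq_max tK.
- rewrite big_cons geq_max; apply/andP; split.
    exact: h0.
  elim: (m) => [|k IH] /=; first by rewrite big_nil.
  by rewrite big_cons geq_max IH andbT.
- rewrite big_map; elim: qs hq => [|q s IH] /=; first by rewrite big_nil.
  by case/andP=> /andP[c w] /IH h; rewrite big_cons !geq_max c w h.
Qed.

(** * Expressions computing the conflict relation *)

Definition e_not (a : exp) : exp := Monus (Cst 1) a.
Definition e_and (a b : exp) : exp := Mul a b.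
Definition e_or (a b : exp) : exp := e_not (e_and (e_not a) (e_not b)).
Definition e_leq (a b : exp) : exp := e_not (Monus a b).
Definition e_eq (a b : exp) : exp := e_and (e_leq a b) (e_leq b a).

Fixpoint e_poly (s : seq nat) (e : exp) : exp :=
  if s is c :: s' then Add (Mul (e_poly s' e) e) (Cst c) else Cst 0.

(** D depends on the verifying machine only, so a predicate on its entries unfolds into an
    expression of fixed size. *)
Definition e_table (R : nat -> bool) (D : nat) (a : exp) : exp :=
  foldr (fun c e => Add (Mul (e_eq a (Cst c)) (Cst (R c))) e) (Cst 0) (iota 0 D).

Definition e_table2 (R : nat -> nat -> bool) (D : nat) (a b : exp) : exp :=
  foldr (fun c e => Add (Mul (e_eq a (Cst c)) (e_table (R c) D b)) e) (Cst 0) (iota 0 D).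

Section Evaluation.

Variables (z : seq bool) (r : seq nat).

Definition evals (e : exp) (v : nat) : Prop := ev z r e = v.

Lemma evals_var l v : nth 0 r l = v -> evals (Var l) v. Proof. by []. Qed.

Lemma evals_cst c : evals (Cst c) c. Proof. by []. Qed.

Lemma evals_add a b x y : evals a x -> evals b y -> evals (Add a b) (x + y).
Proof. by move=> <- <-. Qed.

Lemma evals_mul a b x y : evals a x -> evals b y -> evals (Mul a b) (x * y).
Proof. by move=> <- <-. Qed.

Lemma evals_sub a b x y : evals a x -> evals b y -> evals (Monus a b) (x - y).
Proof. by move=> <- <-. Qed.

Lemma evals_bit a x : evals a x -> evals (Bit a) (nth false z x).
Proof. by rewrite /evals /= => ->. Qed.

Lemma evals_not a (x : bool) : evals a x -> evals (e_not a) (~~ x).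
Proof. by rewrite /evals /= => ->; case: x. Qed.

Lemma evals_and a b (x y : bool) : evals a x -> evals b y -> evals (e_and a b) (x && y).
Proof. by rewrite /evals /= => -> ->; case: x; case: y. Qed.

Lemma evals_or a b (x y : bool) : evals a x -> evals b y -> evals (e_or a b) (x || y).
Proof. by rewrite /evals /= => -> ->; case: x; case: y. Qed.

Lemma evals_leq a b x y : evals a x -> evals b y -> evals (e_leq a b) (x <= y).
Proof. by rewrite /evals /= => -> ->; rewrite /leq; case: (x - y). Qed.

Lemma evals_eq a b x y : evals a x -> evals b y -> evals (e_eq a b) (x == y).
Proof.
by move=> ax bY; rewrite eqn_leq; apply: evals_and; apply: evals_leq.
Qed.

Lemma evals_poly (p : {poly nat}) a x : evals a x -> evals (e_poly p a) p.[x]%R.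
Proof.
rewrite /evals /horner => <-; elim: (polyseq p) => //= c s ->.
by [].
Qed.

Lemma sum_eq_iota (f : nat -> nat) a D : a < D ->
  foldr (fun c s => (a == c) * f c + s) 0 (iota 0 D) = f a.
Proof.
move=> aD; have : forall j k, foldr (fun c s => (a == c) * f c + s) 0 (iota j k) =
    (j <= a < j + k) * f a.
  move=> j k; elim: k j => [|k IH] j /=.
    by rewrite addn0 ltnNge; case: leqP.
  by rewrite IH; case: eqP => [<-|ne]; lia.
by move=> ->; rewrite add0n aD mul1n.
Qed.

Lemma evals_table (R : nat -> bool) D a x : x < D -> evals a x -> evals (e_table R D a) (R x).
Proof.
move=> xD ax; rewrite /evals -(sum_eq_iota (fun c => R c) xD) /e_table.
elim: (iota 0 D) => //= c s ->.
by have := evals_eq ax (evals_cst c); rewrite /evals => /= ->.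
Qed.

Lemma evals_table2 (R : nat -> nat -> bool) D a b x y : x < D -> y < D ->
  evals a x -> evals b y -> evals (e_table2 R D a b) (R x y).
Proof.
move=> xD yD ax bY; rewrite /evals -(sum_eq_iota (fun c => R c y) xD) /e_table2.
elim: (iota 0 D) => //= c s ->.
have := evals_eq ax (evals_cst c); rewrite /evals => /= ->.
by have := evals_table (R c) yD bY; rewrite /evals => ->.
Qed.

End Evaluation.

Definition p_seq (s : seq prog) : prog := foldr PSeq PNil s.

Definition p_rat (e : exp) : prog := p_seq [:: PBit (Cst 0); PNat e; PNat (Cst 1)].

(* [l] is the level of the variable bound by the loop, [m] the number of edges. *)
Definition p_toll (l : nat) (m lo hi cap wt : exp) : prog :=
  p_seq [:: PBit (Cst 1); PFor m (PBit (e_and (e_leq lo (Var l)) (e_leq (Var l) hi)));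
            PNat cap; PNat wt].

(** The bounds of a toll are evaluated inside a further loop. De Bruijn levels make their values
    insensitive to the variables added at the end. *)
Definition evals_ext (z : seq bool) (r : seq nat) (e : exp) (v : nat) : Prop :=
  forall s, evals z (r ++ s) e v.

Lemma evals_ext0 z r e v : evals_ext z r e v -> ev z r e = v.
Proof. by move=> h; have := h [::]; rewrite cats0. Qed.

Lemma pv_toll z r m lo_ hi_ cap_ wt_ me (q : toll) :
  evals_ext z r me m -> evals_ext z r lo_ (lo q) -> evals_ext z r hi_ (hi q) ->
  evals_ext z r cap_ (cap q) -> evals_ext z r wt_ (wt q) ->
  pv z r (p_toll (size r) me lo_ hi_ cap_ wt_) = true :: enc_toll m q.
Proof.
move=> hm hl hh hc hw; rewrite /p_toll /p_seq /foldr /pv -/pv.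
rewrite (evals_ext0 hm) (evals_ext0 hc) (evals_ext0 hw) /enc_toll cats0.
congr (_ :: _ ++ _); rewrite -(flatten_map1 (fun e => lo q <= e <= hi q)); congr flatten.
apply: eq_map => e; congr [:: _]; rewrite -cats1.
have hv : evals z (r ++ [:: e]) (Var (size r)) e.
  by apply: evals_var; rewrite nth_cat ltnn subnn.
have := evals_and (evals_leq (hl [:: e]) hv) (evals_leq hv (hh [:: e])).
by rewrite /evals => ->; case: (_ && _).
Qed.

Section Reduction.

Variables (M : machine) (p q : {poly nat}).

Section Bounds.

Variable x : seq bool.

Definition cert_bound : nat := p.[size x]%R.
Definition input_bound : nat := 2 * size x + 1 + cert_bound.
Definition time_bound : nat := q.[input_bound]%R.
Definition radius : nat := time_bound + input_bound.
Definition nb_cells : nat := time_bound.+1 * width radius.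
Definition nb_blocks : nat := nb_cells * alphabet_size M.
Definition conflicting : nat -> nat -> bool :=
  block_conflict M x radius time_bound cert_bound.

Definition reduction : fza :=
  path_fza (3 * nb_blocks) (gadget_tolls nb_blocks conflicting)
    (gadget_target nb_blocks nb_cells).

End Bounds.

Notation D := (alphabet_size M).

Definition e_cert : exp := e_poly p (Var 0).
Definition e_twice : exp := Mul (Cst 2) (Var 0).
Definition e_input : exp := Add (Add e_twice (Cst 1)) e_cert.
Definition e_time : exp := e_poly q e_input.
Definition e_radius : exp := Add e_time e_input.
Definition e_width : exp := Add (Cst 1) (Mul (Cst 2) e_radius).
Definition e_rows : exp := Add (Cst 1) e_time.
Definition e_cells : exp := Mul e_rows e_width.
Definition e_blocks : exp := Mul e_cells (Cst D).
Definition e_pair_weight : exp := Add (Cst 1) e_blocks.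
Definition e_block_weight : exp :=
  Add (Mul (Mul (Mul (Cst 2) e_blocks) e_blocks) e_pair_weight) (Add (Cst 1) e_blocks).
Definition e_target : exp :=
  Add (Add (Mul (Mul (Cst 2) e_blocks) e_block_weight)
           (Mul (Mul e_blocks e_blocks) e_pair_weight)) e_cells.
Definition e_edges : exp := Mul (Cst 3) e_blocks.

Definition e_t := Var 1.
Definition e_o := Var 2.
Definition e_a := Var 3.
Definition e_t' := Var 4.
Definition e_o' := Var 5.
Definition e_a' := Var 6.

Definition on_entry (f : entry M -> bool) : exp :=
  e_table (fun a => f (decode_entry M a)) D e_a.

Definition on_entries (f : entry M -> entry M -> bool) : exp :=
  e_table2 (fun a a' => f (decode_entry M a) (decode_entry M a')) D e_a e_a'.

Definition e_lt (a b : exp) : exp := e_leq (Add (Cst 1) a) b.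
Definition e_first : exp := e_eq e_t (Cst 0).
Definition e_at_head : exp := e_eq e_o e_radius.
Definition e_input_bit : exp := Bit (Monus e_o e_radius).

(** A table depends on the two entries alone, so the flag telling whether [o] is the head position
    is resolved by cases; the input bit in [e_entry_conflict] is treated likewise. *)
Definition e_vertical (k : nat) : exp :=
  e_or (e_and e_at_head (on_entries (fun v v' => ~~ vertical_ok k true v v')))
       (e_and (e_not e_at_head) (on_entries (fun v v' => ~~ vertical_ok k false v v'))).

Definition e_entry_conflict : exp :=
  e_or (e_and e_at_head (on_entry (fun v => ~~ center_ok v)))
  (e_or (e_and e_first (on_entry (fun v => ~~ start_ok v)))
  (e_or (e_and e_first (e_and (e_lt e_o e_radius) (on_entry (fun v => ~~ sym_is None v))))
  (e_or (e_and e_first (e_and (e_leq e_radius e_o) (e_and (e_leq e_o (Add e_radius e_twice))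
     (e_or (e_and e_input_bit (on_entry (fun v => ~~ sym_is (Some (inl true)) v)))
           (e_and (e_not e_input_bit) (on_entry (fun v => ~~ sym_is (Some (inl false)) v)))))))
  (e_or (e_and e_first (e_and (e_lt (Add e_radius e_twice) e_o)
     (on_entry (fun v => ~~ not_aux v))))
  (e_or (e_and e_first (e_and (e_lt (Add (Add e_radius e_twice) e_cert) e_o)
     (on_entry (fun v => ~~ sym_is None v))))
  (e_and (e_eq e_t e_time) (e_and e_at_head
     (on_entry (fun v => ~~ sym_is (Some (inl true)) v))))))))).

Definition e_pair_conflict : exp :=
  let next e := Add (Cst 1) e in
  e_or (e_and (e_eq e_t' e_t) (e_and (e_eq e_o' (next e_o))
     (on_entries (fun v v' => ~~ horizontal_ok v v'))))
  (e_or (e_and e_first (e_and (e_eq e_t' (Cst 0)) (e_and (e_eq e_o' (next e_o))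
     (e_and (e_leq e_radius e_o) (on_entries (fun v v' => ~~ blank_spreads v v'))))))
  (e_or (e_and (e_eq e_t' (next e_t)) (e_and (e_eq e_o' e_o) (e_vertical 0)))
  (e_or (e_and (e_eq e_t' (next e_t)) (e_and (e_eq e_o' (next e_o)) (e_vertical 1)))
        (e_and (e_eq e_t' (next e_t)) (e_and (e_eq e_o (next e_o')) (e_vertical 2)))))).

Definition e_conflict : exp :=
  e_or (e_and (e_eq e_t e_t') (e_and (e_eq e_o e_o') (e_lt e_a e_a')))
  (e_or (e_and (e_eq e_t e_t') (e_and (e_eq e_o e_o') (e_and (e_eq e_a e_a') e_entry_conflict)))
        e_pair_conflict).

Section Correctness.

Variable x : seq bool.

Notation z := (doubled x).
Notation n := (size x).

Lemma evals_params s :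
  [/\ evals z (n :: s) e_twice (2 * n), evals z (n :: s) e_cert (cert_bound x),
      evals z (n :: s) e_time (time_bound x), evals z (n :: s) e_radius (radius x) &
      evals z (n :: s) e_width (width (radius x))].
Proof.
have h0 : evals z (n :: s) (Var 0) n by [].
have h1 : evals z (n :: s) e_twice (2 * n) by apply: evals_mul.
have h2 : evals z (n :: s) e_cert (cert_bound x) by apply: evals_poly.
have h3 : evals z (n :: s) e_input (input_bound x) by do 2 apply: evals_add => //.
have h4 : evals z (n :: s) e_time (time_bound x) by apply: evals_poly.
have h5 : evals z (n :: s) e_radius (radius x) by apply: evals_add.
by split=> //; apply: (@evals_add _ _ _ _ 1); [|apply: evals_mul].
Qed.

Lemma evals_sizes s :
  [/\ evals z (n :: s) e_cells (nb_cells x), evals z (n :: s) e_blocks (nb_blocks x),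
      evals z (n :: s) e_edges (3 * nb_blocks x) & evals z (n :: s) e_rows (time_bound x).+1].
Proof.
have [_ _ h3 h4 h5] := evals_params s.
have h6 : evals z (n :: s) e_rows (time_bound x).+1 by apply: (@evals_add _ _ _ _ 1).
have h7 : evals z (n :: s) e_cells (nb_cells x) by apply: evals_mul.
have h8 : evals z (n :: s) e_blocks (nb_blocks x) by apply: evals_mul.
by split=> //; apply: evals_mul.
Qed.

Lemma evals_weights s :
  [/\ evals z (n :: s) e_pair_weight (pair_weight (nb_blocks x)),
      evals z (n :: s) e_block_weight (block_weight (nb_blocks x)) &
      evals z (n :: s) e_target (gadget_target (nb_blocks x) (nb_cells x))].
Proof.
have [h1 h2 _ _] := evals_sizes s.
have h3 : evals z (n :: s) e_pair_weight (pair_weight (nb_blocks x)).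
  by apply: (@evals_add _ _ _ _ 1).
have h4 : evals z (n :: s) e_block_weight (block_weight (nb_blocks x)).
  by apply: evals_add => //; do 3 apply: evals_mul => //.
split=> //; apply: evals_add => //; apply: evals_add.
  by do 2 apply: evals_mul => //.
by do 2 apply: evals_mul => //.
Qed.

Lemma evals_conflict t o a t' o' a' s : a < D -> a' < D ->
  evals z [:: n, t, o, a, t', o', a' & s] e_conflict
    (conflict M x (radius x) (time_bound x) (cert_bound x) t o a t' o' a').
Proof.
move=> aD aD'; set r := [:: n, t, o, a, t', o', a' & s].
have [h1 h2 h3 h4 h5] := evals_params [:: t, o, a, t', o', a' & s].
rewrite -/r in h1 h2 h3 h4 h5.
have lt e e' v v' : evals z r e v -> evals z r e' v' -> evals z r (e_lt e e') (v < v').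
  by move=> he he'; apply: evals_leq => //; apply: (@evals_add _ _ _ _ 1).
have next e v : evals z r e v -> evals z r (Add (Cst 1) e) v.+1.
  by move=> he; apply: (@evals_add _ _ _ _ 1).
have un f : evals z r (on_entry f) (f (decode_entry M a)).
  by apply: (evals_table (fun a => f (decode_entry M a))).
have bin f : evals z r (on_entries f) (f (decode_entry M a) (decode_entry M a')).
  by apply: (evals_table2 (fun a a' => f (decode_entry M a) (decode_entry M a'))).
have ht : evals z r e_t t by [].
have ho : evals z r e_o o by [].
have ha : evals z r e_a a by [].
have ht' : evals z r e_t' t' by [].
have ho' : evals z r e_o' o' by [].
have ha' : evals z r e_a' a' by [].
have hf : evals z r e_first (t == 0) by apply: evals_eq.
have hh : evals z r e_at_head (o == radius x) by apply: evals_eq.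
have vert k : evals z r (e_vertical k)
    (~~ vertical_ok k (o == radius x) (decode_entry M a) (decode_entry M a')).
  have e : ~~ vertical_ok k (o == radius x) (decode_entry M a) (decode_entry M a') =
      (o == radius x) && ~~ vertical_ok k true (decode_entry M a) (decode_entry M a') ||
      ~~ (o == radius x) && ~~ vertical_ok k false (decode_entry M a) (decode_entry M a').
    by case: (o == radius x); rewrite ?orbF.
  by rewrite e; apply: evals_or; apply: evals_and => //; apply: evals_not.
apply: evals_or; first by do 2 (apply: evals_and; first exact: evals_eq); apply: lt.
apply: evals_or.
  do 3 (apply: evals_and; first exact: evals_eq).
  apply: evals_or; first by apply: evals_and => //; apply: un.
  apply: evals_or; first by apply: evals_and => //; apply: un.
  apply: evals_or; first by do 2 (apply: evals_and; first by [|apply: lt]); apply: un.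
  apply: evals_or.
    do 3 (apply: evals_and; first by [|apply: evals_leq => //; apply: evals_add]).
    set b := nth _ _ _; have hb : evals z r e_input_bit b.
      by apply: evals_bit; apply: evals_sub.
    have e : ~~ sym_is (Some (inl b)) (decode_entry M a) =
      b && ~~ sym_is (Some (inl true)) (decode_entry M a) ||
      ~~ b && ~~ sym_is (Some (inl false)) (decode_entry M a).
      by case: (b); rewrite ?orbF.
    by rewrite e; apply: evals_or; apply: evals_and => //; apply: evals_not.
  apply: evals_or.
    by do 2 (apply: evals_and; first by [|apply: lt => //; apply: evals_add]); apply: un.
  apply: evals_or.
    by do 2 (apply: evals_and; first by [|apply: lt => //; do 2 apply: evals_add => //]); apply: un.
  by do 2 (apply: evals_and; first by [|apply: evals_eq]); apply: un.
apply: evals_or; first by do 2 (apply: evals_and; first by apply: evals_eq => //; apply: next); apply: bin.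
apply: evals_or.
  by do 4 (apply: evals_and; first by
     [|apply: evals_eq|apply: evals_eq => //; apply: next|apply: evals_leq]); apply: bin.
apply: evals_or; first by do 2 (apply: evals_and; first by apply: evals_eq => //; apply: next).
apply: evals_or; first by do 2 (apply: evals_and; first by apply: evals_eq => //; apply: next).
by do 2 (apply: evals_and; first by apply: evals_eq => //; apply: next).
Qed.

End Correctness.

End Reduction.

Lemma pv_for z r e p v (F : nat -> seq bool) :
  evals z r e v -> (forall i, i < v -> pv z (rcons r i) p = F i) ->
  pv z r (PFor e p) = flatten [seq F i | i <- iota 0 v].
Proof.
move=> hv hF /=; rewrite hv; congr flatten; apply/eq_in_map => i.
by rewrite mem_iota add0n; apply: hF.
Qed.

Lemma pv_p_seq z r s : pv z r (p_seq s) = flatten [seq pv z r p | p <- s].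
Proof. by elim: s => //= p s ->. Qed.

Lemma flatten_iota_mul (A B : nat) (F : nat -> seq bool) :
  flatten [seq F b | b <- iota 0 (A * B)] =
  flatten [seq flatten [seq F (i * B + j) | j <- iota 0 B] | i <- iota 0 A].
Proof.
rewrite iota_mul; elim: (iota 0 A) => //= i s IH.
by rewrite map_cat flatten_cat IH -map_comp.
Qed.

(** * The program that writes the instance *)

Section Program.

Variables (M : machine) (p q : {poly nat}).

Notation D := (alphabet_size M).
Notation e_blocks := (e_blocks M p q).
Notation e_edges := (e_edges M p q).
Notation e_block_weight := (e_block_weight M p q).
Notation e_pair_weight := (e_pair_weight M p q).
Notation e_conflict := (e_conflict M p q).
Notation e_width := (e_width p q).
Notation e_rows := (e_rows p q).

Definition p_block_tolls : prog :=
  let b := Mul (Cst 3) (Var 1) in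
  let p_toll := p_toll 2 e_edges in
  p_seq [:: p_toll b (Add b (Cst 1)) (Cst 1) e_block_weight;
            p_toll (Add b (Cst 2)) (Add b (Cst 2)) (Cst 1) e_block_weight;
            p_toll b b (Cst 1) (Cst 1)].

Definition e_block (t o a : exp) : exp := Add (Mul (Add (Mul t e_width) o) (Cst D)) a.

Definition p_pair_tolls : prog :=
  let b := e_block e_t e_o e_a in
  let b' := e_block e_t' e_o' e_a' in
  let k := e_conflict in
  let spare := Add (Mul (Cst 3) b) (Cst 2) in
  p_seq [:: p_toll 7 e_edges (Monus spare k)
              (Add (Mul k (Mul (Cst 3) b')) (Mul (Monus (Cst 1) k) spare))
              (Add (Mul k (Monus (Mul (Cst 2) (Monus b' b)) (Cst 1))) (Monus (Cst 1) k))
              e_pair_weight;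
            p_toll 7 e_edges (Monus spare k) (Monus spare k) k e_pair_weight].

Definition p_entries (body : prog) : prog := PFor e_rows (PFor e_width (PFor (Cst D) body)).

Definition program : prog :=
  p_seq [:: PNat (Add (Cst 1) e_edges);
            PFor e_edges (p_seq [:: PBit (Cst 1); PNat (Var 1); PNat (Add (Cst 1) (Var 1))]);
            PBit (Cst 0);
            PBit (Cst 1); p_rat (Cst 0);
            PFor e_edges (p_seq [:: PBit (Cst 1); p_rat (Cst 1)]);
            PBit (Cst 0);
            PFor e_blocks p_block_tolls;
            p_entries (p_entries p_pair_tolls);
            PBit (Cst 0);
            p_rat (e_target M p q)].

Variable x : seq bool.

Notation z := (doubled x).
Notation n := (size x).
Notation N := (nb_blocks M p q x).
Notation kappa := (conflicting M p q x).

Lemma pv_rat r e v : evals z r e v -> pv z r (p_rat e) = enc_rat_nat v.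
Proof. by move=> h; rewrite /p_rat pv_p_seq /map /flatten /foldr cats0 -[pv z r (PNat e)]/(enc_nat (ev z r e)) h. Qed.

Lemma pv_block_tolls b :
  pv z [:: n; b] p_block_tolls = enc_tolls (3 * N) (block_tolls N b).
Proof.
rewrite /p_block_tolls pv_p_seq /enc_tolls; congr flatten.
have he : evals_ext z [:: n; b] e_edges (3 * N).
  by move=> s; have [] := evals_sizes M p q x (b :: s).
have hw : evals_ext z [:: n; b] e_block_weight (block_weight N).
  by move=> s; have [] := evals_weights M p q x (b :: s).
have hb : evals_ext z [:: n; b] (Mul (Cst 3) (Var 1)) (3 * b) by move=> s.
have hc k : evals_ext z [:: n; b] (Cst k) k by move=> s.
have hbk k : evals_ext z [:: n; b] (Add (Mul (Cst 3) (Var 1)) (Cst k)) (3 * b + k) by move=> s.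
rewrite /block_tolls /map; congr [:: _; _; _].
- exact: (@pv_toll z [:: n; b] (3 * N) _ _ _ _ _ (Toll (3 * b) (3 * b + 1) 1 (block_weight N))).
- exact: (@pv_toll z [:: n; b] (3 * N) _ _ _ _ _ (Toll (3 * b + 2) (3 * b + 2) 1 (block_weight N))).
- exact: (@pv_toll z [:: n; b] (3 * N) _ _ _ _ _ (Toll (3 * b) (3 * b) 1 1)).
Qed.

Lemma pv_pair_tolls t o a t' o' a' :
  o < width (radius p q x) -> a < D -> o' < width (radius p q x) -> a' < D ->
  pv z [:: n; t; o; a; t'; o'; a'] p_pair_tolls =
  enc_tolls (3 * N)
    (pair_tolls N kappa (block M (radius p q x) t o a) (block M (radius p q x) t' o' a')).
Proof.
move=> oW aD oW' aD'.
set b := block M _ t o a; set b' := block M _ t' o' a'.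
rewrite /p_pair_tolls pv_p_seq /enc_tolls; congr flatten.
set r := [:: n; t; o; a; t'; o'; a'].
have he : evals_ext z r e_edges (3 * N).
  by move=> s; have [] := evals_sizes M p q x ([:: t; o; a; t'; o'; a'] ++ s).
have hw : evals_ext z r e_pair_weight (pair_weight N).
  by move=> s; have [] := evals_weights M p q x ([:: t; o; a; t'; o'; a'] ++ s).
have hb : evals_ext z r (e_block e_t e_o e_a) b.
  move=> s; have [_ _ _ _ h] := evals_params p q x ([:: t; o; a; t'; o'; a'] ++ s).
  by do 2 (apply: evals_add => //; apply: evals_mul => //).
have hb' : evals_ext z r (e_block e_t' e_o' e_a') b'.
  move=> s; have [_ _ _ _ h] := evals_params p q x ([:: t; o; a; t'; o'; a'] ++ s).
  by do 2 (apply: evals_add => //; apply: evals_mul => //).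
have hk : evals_ext z r e_conflict (kappa b b').
  by move=> s; rewrite /conflicting block_conflictE //; apply: evals_conflict.
have hc k : evals_ext z r (Cst k) k by move=> s.
have hs : evals_ext z r (Add (Mul (Cst 3) (e_block e_t e_o e_a)) (Cst 2)) (3 * b + 2).
  by move=> s; apply: evals_add => //; apply: evals_mul => //; apply: hb.
have hl : evals_ext z r (Monus (Add (Mul (Cst 3) (e_block e_t e_o e_a)) (Cst 2)) e_conflict)
    (3 * b + 2 - kappa b b').
  by move=> s; apply: evals_sub; [apply: hs | apply: hk].
have hn : evals_ext z r (Monus (Cst 1) e_conflict) (1 - kappa b b').
  by move=> s; apply: evals_sub => //; apply: hk.
rewrite /pair_tolls /map; congr [:: _; _].
- apply: (@pv_toll z r (3 * N) _ _ _ _ _ (Toll (3 * b + 2 - kappa b b')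
    (kappa b b' * (3 * b') + (1 - kappa b b') * (3 * b + 2))
    (kappa b b' * (2 * (b' - b) - 1) + (1 - kappa b b')) (pair_weight N))) => //= s.
  + apply: evals_add; apply: evals_mul; [exact: hk | | exact: hn | exact: hs].
    by apply: evals_mul => //; apply: hb'.
  + apply: evals_add; [apply: evals_mul; [exact: hk |] | exact: hn].
    apply: evals_sub => //; apply: evals_mul => //.
    by apply: evals_sub; [apply: hb' | apply: hb].
- exact: (@pv_toll z r (3 * N) _ _ _ _ _ (Toll (3 * b + 2 - kappa b b')
    (3 * b + 2 - kappa b b') (kappa b b') (pair_weight N))).
Qed.

(** Nested loops over t, o and a enumerate the blocks in the order of their numbers. *)
Lemma pv_entries s body (F : nat -> seq bool) :
  (forall t o a, o < width (radius p q x) -> a < D ->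
     pv z (n :: s ++ [:: t; o; a]) body = F (block M (radius p q x) t o a)) ->
  pv z (n :: s) (p_entries body) = flatten [seq F b | b <- iota 0 N].
Proof.
move=> h; rewrite /nb_blocks /nb_cells !flatten_iota_mul.
have [_ _ _ hr] := evals_sizes M p q x s.
apply: pv_for hr _ => t _; rewrite [rcons _ _]/=.
have [_ _ _ _ hw] := evals_params p q x (rcons s t).
apply: pv_for hw _ => o oW.
apply: pv_for (evals_cst _ _ _) _ => a aD.
by rewrite -h // /= -!cats1 -!catA.
Qed.

Lemma pv_program : pv z [:: n] program = fza_encode (reduction M p q x).
Proof.
have [_ hN hm _] := evals_sizes M p q x [::].
have [_ _ ht] := evals_weights M p q x [::].
rewrite encode_path /program pv_p_seq /map /flatten /foldr.
rewrite (pv_rat ht) (pv_rat (evals_cst _ _ 0)).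
rewrite (pv_for (F := fun i => true :: enc_nat i ++ enc_nat i.+1) hm); last first.
  by move=> i _; rewrite pv_p_seq /= cats0.
rewrite (pv_for (F := fun i => true :: enc_rat_nat 1) hm); last first.
  by move=> i _; rewrite pv_p_seq /map /flatten /foldr (pv_rat (evals_cst _ _ 1)) cats0.
rewrite (pv_for (F := fun b => enc_tolls (3 * N) (block_tolls N b)) hN); last first.
  by move=> i _; apply: pv_block_tolls.
rewrite (@pv_entries [::] _ (fun b => enc_tolls (3 * N)
    (flatten [seq pair_tolls N kappa b b' | b' <- iota 0 N]))); last first.
  move=> t o a oW aD; rewrite enc_tolls_flatten.
  apply: (@pv_entries [:: t; o; a]) => t' o' a' oW' aD'.
  exact: pv_pair_tolls.
rewrite /gadget_tolls enc_tolls_cat !enc_tolls_flatten.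
have e0 : pv z [:: n] (PNat (Add (Cst 1) e_edges)) = enc_nat (3 * N).+1.
  by congr enc_nat; rewrite -[in RHS]hm.
rewrite e0 -[pv _ _ (PBit (Cst 0))]/[:: false] -[pv _ _ (PBit (Cst 1))]/[:: true].
rewrite !cats0 !cat_cons -!catA.
by [].
Qed.

End Program.

(** * Correctness of the reduction *)

Lemma horner_nat_leq (p : {poly nat}) a b : a <= b -> p.[a]%R <= p.[b]%R.
Proof.
move=> ab; rewrite /horner; elim: (polyseq p) => //= c s IH.
by rewrite leq_add2r leq_mul.
Qed.

(** One time bound serves all certificates: polynomials with natural coefficients are monotone and
    halting configurations persist. Since the output is known to be one bit, the scanned symbol
    decides. *)
Lemma reduction_accepts (V : seq bool -> bool) (M : machine) (p q : {poly nat}) :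
  (forall x, let c := iter q.[size x]%R (@step M) (init M x) in
     halting c.1 /\ output c = [:: V x]) ->
  forall x, (exists y, size y <= p.[size x]%R /\ V (enc_pair x y)) <->
    exists2 y, size y <= cert_bound p x &
      scanned ((run M x y (time_bound p q x)).2 ord0) = Some (inl true).
Proof.
move=> hV x.
have acc y : size y <= cert_bound p x ->
    (scanned ((run M x y (time_bound p q x)).2 ord0) = Some (inl true)) <-> V (enc_pair x y).
  move=> hy; have [h o] := hV (enc_pair x y).
  have le : q.[size (enc_pair x y)]%R <= time_bound p q x.
    apply: horner_nat_leq; rewrite enc_pairE size_cat size_rcons size_doubled -mul2n.
    by rewrite /input_bound; lia.
  rewrite /run (iter_step_halted h le); move: o; rewrite /output /scanned.
  case: (_.2) => [|[[b|]|] s] //= [-> _].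
  by split=> [[->]|->].
by split=> [[y [h1 h2]]|[y h1 h2]]; exists y => //; [apply/acc | split=> //; apply/acc].
Qed.

Lemma reduction_yes (M : machine) (p q : {poly nat}) x :
  fza_yes (reduction M p q x) <->
  exists2 y, size y <= cert_bound p x &
    scanned ((run M x y (time_bound p q x)).2 ord0) = Some (inl true).
Proof.
have B0 : 0 < radius p q x by rewrite /radius /input_bound; lia.
have N0 : 0 < nb_blocks M p q x by rewrite !muln_gt0 alphabet_gt0.
have le b b' : conflicting M p q x b b' -> b <= b' by exact: (block_conflict_leq B0).
have m0 : 0 < 3 * nb_blocks M p q x by rewrite muln_gt0.
apply: iff_trans (path_yes (gadget_target _ (nb_cells p q x)) m0 (gadget_tolls_ok _ _)) _.
apply: iff_trans (gadget_correct _ _ le) _.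
by apply: conflict_free; rewrite /radius /input_bound; lia.
Qed.

(** Let u = 3 N + 2, at most the encoding length plus 2. Block weights are at most u^4 and the
    target is a sum of three terms bounded by u^5, hence at most u^6. *)
Lemma reduction_maxnum (M : machine) (p q : {poly nat}) x :
  fza_maxnum (reduction M p q x) <= (size (fza_encode (reduction M p q x)) + 2) ^ 6.
Proof.
have N0 : 0 < nb_blocks M p q x by rewrite !muln_gt0 alphabet_gt0.
have sN : 3 * nb_blocks M p q x + 2 <= size (fza_encode (reduction M p q x)) + 2.
  by rewrite leq_add2r size_encode_path.
apply: leq_trans (_ : (3 * nb_blocks M p q x + 2) ^ 6 <= _); last by rewrite leq_exp2r.
have JN : nb_cells p q x <= nb_blocks M p q x by rewrite leq_pmulr ?alphabet_gt0.
rewrite /reduction; move: (nb_blocks _ _ _ _) (nb_cells _ _ _) N0 JN (conflicting _ _ _ _) => N J N0 JN kappa.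
have pw : pair_weight N <= 3 * N + 2 by rewrite /pair_weight; lia.
set u := 3 * N + 2 in pw *.
have u0 : 0 < u by rewrite /u addn2.
have bw : block_weight N <= u ^ 4.
  rewrite /block_weight /pair_weight.
  by rewrite !expnS expn0 /u; nia.
have up e : e <= 6 -> u ^ e <= u ^ 6 by move=> h; rewrite leq_pexp2l.
apply: maxnum_path; first by rewrite expn_gt0 u0.
  rewrite /gadget_target.
  have h1 : 2 * N * block_weight N <= u * u ^ 4 by apply: leq_mul => //; rewrite /u; lia.
  have h2 : N * N * pair_weight N <= u ^ 3.
    by rewrite !expnS expn0 muln1 mulnA; do 2 apply: leq_mul => //; rewrite /u; lia.
  have h3 : J <= u by rewrite /u; lia.
  have h4 : u ^ 3 <= u ^ 5 by rewrite leq_pexp2l.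
  have h5 : u <= u ^ 5 by rewrite -{1}(expn1 u) leq_pexp2l.
  have h6 : 3 * u ^ 5 <= u ^ 6 by rewrite [u ^ 6]expnS leq_mul2r /u; lia.
  by rewrite -expnS in h1; lia.
have u6 : u <= u ^ 6 by rewrite -{1}(expn1 u) leq_pexp2l.
have capP c : c <= u -> c <= u ^ 6 by move/leq_trans; apply.
rewrite all_cat; apply/andP; split; rewrite all_flatten all_map; apply/allP => b;
  rewrite mem_iota /= => bN.
  by rewrite (leq_trans bw (up 4 isT)) !capP // /u; lia.
rewrite all_flatten all_map; apply/allP => b'; rewrite mem_iota /= => bN'.
rewrite !(capP _ pw) !capP // /u; case: (kappa b b'); rewrite ?mul1n ?mul0n /=; lia.
Qed.

Lemma reduction_spec (L : seq bool -> Prop) : NP L ->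
  exists g : seq bool -> fza,
    polytime (fun x => fza_encode (g x)) /\
    forall x, [/\ fza_valid (g x), tree_is_path (g x),
      fza_maxnum (g x) <= (size (fza_encode (g x)) + 2) ^ 6 & L x <-> fza_yes (g x)].
Proof.
move=> [V [p [[M [q hV]] hL]]]; exists (reduction M p q); split.
  have -> : (fun x => fza_encode (reduction M p q x)) =
            (fun x => pv (doubled x) [:: size x] (program M p q)).
    by apply: functional_extensionality => x; rewrite pv_program.
  exact: pv_polytime.
move=> x; have m0 : 0 < 3 * nb_blocks M p q x by rewrite !muln_gt0 alphabet_gt0.
split.
- by apply: path_valid => //; apply: gadget_tolls_ok.
- by apply: path_tree_is_path.
- exact: reduction_maxnum.
- apply: iff_trans (hL x) _; apply: iff_trans (reduction_accepts p hV x) _.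
  exact: iff_sym (reduction_yes M p q x).
Qed.

Theorem theorem5 :
  strongly_NP_hard FZA /\ strongly_NP_hard (restrict (Pi := FZA) tree_is_path).
Proof.
have e m : (('X + 2%:R) ^+ 6).[m]%R = (m + 2) ^ 6.
  by rewrite horner_exp hornerD hornerX -[2%:R%R]polyC_natr hornerC -natrXE.
(* The same reduction proves both claims, all its instances being paths. *)
split; exists (('X + 2%:R) ^+ 6)%R => L /reduction_spec[g [hp hg]]; exists g; split=> // x;
  have [h1 h2 h3 h4] := hg x; split=> //; split=> //; first by rewrite e.
by rewrite e.
Qed.
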